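(* Let $S$ be an inverse semigroup and $X\subseteq E(S)\times \mathcal{P}_{fin}(E(S))$. Let further $B$ be a Boolean inverse semigroup and $\varphi\colon S\to B$ an $X$-to-join representation (respectively, a proper $X$-to-join representation). Then there is a unique morphism (respectively, a unique proper morphism) of Boolean inverse semigroups $\psi\colon \mathrm{B}_X(S)\to B$ such that $\varphi=\psi\,\iota_{\mathrm{B}_X(S)}$.
   Context: Conventions. All inverse semigroups have a zero element $0$. For an inverse semigroup $S$, $E(S)$ is its set of idempotents, a semilattice (poset with bottom $0$ and binary meets) under $e\wedge f=ef$; $\mathbf{d}(a)=a^{-1}a$, $\mathbf{r}(a)=aa^{-1}$; the natural partial order is $a\le b$ iff $a=be$ for some $e\in E(S)$; $a\sim b$ (compatible) means that $a^{-1}b$ and $ab^{-1}$ are idempotents. ''Boolean algebra'' means generalized Boolean algebra (relatively complemented distributive lattice with bottom $0$, not necessarily with a top). $\mathcal{P}_{fin}(E)$ is the set of all finite subsets of $E$; an empty join is $0$. Boolean inverse semigroups. An inverse semigroup is Boolean if $E(S)$ is a Boolean algebra and any $a\sim b$ in $S$ have a join $a\vee b$ with respect to the natural partial order. A morphism of Boolean algebras is a map preserving $0,\vee,\wedge,\setminus$ which is proper (i.e. every element of the codomain is below a finite join of elements of the image). A morphism $\varphi\colon S\to T$ of Boolean inverse semigroups is a semigroup morphism such that $\varphi|_{E(S)}\colon E(S)\to E(T)$ is a morphism of Boolean algebras and $\varphi(a\vee b)=\varphi(a)\vee\varphi(b)$ whenever $a\sim b$. Representations. A representation of a semilattice $E$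 in a Boolean algebra $B$ is a map $\varphi\colon E\to B$ with $\varphi(0)=0$ and $\varphi(x\wedge y)=\varphi(x)\wedge\varphi(y)$; it is proper if for every $y\in B$ there are $x_1,\dots,x_n\in E$ with $\varphi(x_1)\vee\dots\vee\varphi(x_n)\ge y$. For $X\subseteq E\times\mathcal{P}_{fin}(E)$, a representation $\varphi\colon E\to B$ is $X$-to-join if it is proper and $\varphi(e)=\bigvee_{i=1}^n\varphi(e_i)$ for all $(e,\{e_1,\dots,e_n\})\in X$. A representation of an inverse semigroup $S$ in a Boolean inverse semigroup $T$ is a semigroup morphism $\varphi\colon S\to T$ whose restriction $E(S)\to E(T)$ is a proper representation of semilattices; it is $X$-to-join (for $X\subseteq E(S)\times\mathcal{P}_{fin}(E(S))$) if this restriction is $X$-to-join. A representation (in particular, a morphism of Boolean inverse semigroups) $\varphi\colon S\to T$ is called proper if for every $t\in T$ there are $n\ge1$, $t_1,\dots,t_n\in T$ and $s_1,\dots,s_n\in S$ with $t=\bigvee_{i=1}^n t_i$ and $\varphi(s_i)\ge t_i$ for all $i$. The semigroup $\mathrm{B}_X(S)$. A character of a semilattice $E$ is a non-zero representation $E\to\{0,1\}$; $\widehat{E}$ is the set of characters with the topology of pointwise convergence (subspace of $\{0,1\}^E$), and $\widehat{E}_X\subseteq\widehat E$ is the closed subset of $X$-to-join characters. $X\subseteq E(S)\times\mathcal{P}_{fin}(E(S))$ is $S$-invariant if $(e,\{e_1,\dots,e_n\})\in X$ implies $(s^{-1}es,\{s^{-1}e_1s,\dots,s^{-1}e_ns\})\in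 X$ for all $s\in S$; $X'$ denotes the smallest $S$-invariant subset containing $X$. $S$ acts on $\widehat{E(S)}$: the domain of $s$ is $\{\varphi:\varphi(\mathbf{d}(s))=1\}$ and $(s\cdot\varphi)(e)=\varphi(s^{-1}es)$. The closed subset $\widehat{E(S)}_{X'}$ is invariant under this action. $\mathcal{G}_X(S)$ is the groupoid of germs of the restricted action on $\widehat{E(S)}_{X'}$: its elements are the classes $[s,\varphi]$, $s\in S$, $\varphi\in\widehat{E(S)}_{X'}$, $\varphi(\mathbf{d}(s))=1$, where $[s,\varphi]=[t,\varphi]$ iff $se=te$ for some $e\in E(S)$ with $\varphi(e)=1$; $[s,\varphi]$ is an arrow from $\varphi$ to $s\cdot\varphi$, with $[s,t\cdot\varphi][t,\varphi]=[st,\varphi]$ and $[s,\varphi]^{-1}=[s^{-1},s\cdot\varphi]$. Its topology has as basis the sets $\{[s,\varphi]\in\mathcal{G}_X(S):\varphi(\mathbf{d}(s))=1,\ \varphi(\mathbf{d}(s_1))=\dots=\varphi(\mathbf{d}(s_n))=0\}$, where $n\ge0$, $s\in S$ and $s_1,\dots,s_n\le s$. $\mathrm{B}_X(S)$ (the $X$-to-join Booleanization of $S$) is the Boolean inverse semigroup of all compact-open bisections of $\mathcal{G}_X(S)$ (subsets on which the domain and range maps are injective), under multiplication of subsets. $\iota_{\mathrm{B}_X(S)}\colon S\to\mathrm{B}_X(S)$ is the $X$-to-join representation $s\mapsto\{[s,\varphi]\in\mathcal{G}_X(S):\varphi(\mathbf{d}(s))=1\}$. *)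

(* Defs.v *)
From HB Require Import structures.
From mathcomp Require Import all_boot all_order finmap.
From mathcomp Require Import all_classical topology.

Set Implicit Arguments.
Unset Strict Implicit.
Unset Printing Implicit Defensive.

Import Order.TTheory.

Declare Scope invsemi_scope.
Delimit Scope invsemi_scope with IS.
Local Open Scope classical_set_scope.
Local Open Scope order_scope.
Local Open Scope invsemi_scope.

HB.mixin Record Semigroup_isInverse S of Semigroup S := {
  sinv : S -> S;
  szero : S;
  mulsVs : forall a : S, mul (mul a (sinv a)) a = a;
  mulVsV : forall a : S, mul (mul (sinv a) a) (sinv a) = sinv a;
  sinv_uniq : forall a b : S,
    mul (mul a b) a = a -> mul (mul b a) b = b -> b = sinv a;
  mul0s : forall a : S, mul szero a = szero;
  muls0 : forall a : S, mul a szero = szero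
}.

#[short(type="invSemigroupType")]
HB.structure Definition InvSemigroup :=
  {S of Semigroup_isInverse S & Semigroup S}.

Bind Scope invsemi_scope with InvSemigroup.sort.
Arguments szero {s}.
(* [mul] would otherwise read its arguments in [group_scope], where [^-1] is
   the inverse of a group. *)
Arguments mul {s} (x y)%_IS : rename.
Notation "x * y" := (mul x y) : invsemi_scope.
Notation "x ^-1" := (sinv x) : invsemi_scope.

Lemma regular_inv_uniq (S : semigroupType) (inv : S -> S) :
  (forall a, a * inv a * a = a) -> (forall a, inv a * a * inv a = inv a) ->
  (forall e f : S, e * e = e -> f * f = f -> e * f = f * e) ->
  forall a b, a * b * a = a -> b * a * b = b -> b = inv a.
Proof.
move=> r1 r2 c a b ab ba; have I1 (x y : S) : x * y * x = x -> (x * y) * (x * y) = x * y.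
  by move=> h; rewrite mulgA h.
have I2 (x y : S) : x * y * x = x -> (y * x) * (y * x) = y * x.
  by move=> h; rewrite mulgA -(mulgA y x y) -(mulgA y) h.
have e1 : b * a = inv a * a.
  rewrite -{1}(r1 a) -!mulgA (mulgA b) (c (b * a) (inv a * a)); last exact: I2.
    by rewrite -!mulgA (mulgA a b) ab.
  exact: I2.
have e2 : a * b = a * inv a.
  rewrite -{1}(r1 a) -!mulgA (mulgA (a)) (c (a * inv a) (a * b)); last exact: I1.
    by rewrite mulgA ab.
  exact: I1.
by rewrite -ba -mulgA e2 mulgA e1 r2.
Qed.

Section InvSemigroupTheory.
Variable S : invSemigroupType.
Implicit Types a b e f s t : S.

Lemma idem_inv e : e * e = e -> e^-1 = e.
Proof. by move=> h; apply/esym/sinv_uniq; rewrite !h. Qed.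

Lemma sinvK a : (a^-1)^-1 = a.
Proof. by apply/esym/sinv_uniq; [exact: mulVsV|exact: mulsVs]. Qed.

Let idem_mul e f : e * e = e -> f * f = f -> (e * f) * (e * f) = e * f.
Proof.
move=> he hf; set x := (e * f)^-1.
have hx : f * x * e = x.
  apply: sinv_uniq.
    have -> : e * f * (f * x * e) * (e * f) = e * (f * f) * x * (e * e) * f.
      by rewrite !mulgA.
    by rewrite he hf -[RHS](mulsVs (e * f)) !mulgA.
  have -> : f * x * e * (e * f) * (f * x * e) = f * (x * ((e * e) * (f * f)) * x) * e.
    by rewrite !mulgA.
  by rewrite he hf mulVsV.
have xx : x * x = x.
  rewrite -{1 2}hx.
  have -> : f * x * e * (f * x * e) = f * (x * (e * f) * x) * e by rewrite !mulgA.
  by rewrite mulVsV hx.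
by rewrite -(sinvK (e * f)) -/x (idem_inv xx).
Qed.

Lemma idemC e f : e * e = e -> f * f = f -> e * f = f * e.
Proof.
move=> he hf; rewrite -[e * f]idem_inv; last exact: idem_mul.
have h (u v : S) : u * u = u -> v * v = v -> (u * v) * (v * u) * (u * v) = u * v.
  move=> hu hv; rewrite -[RHS](idem_mul hu hv).
  have -> : u * v * (v * u) * (u * v) = u * (v * v) * (u * u) * v by rewrite !mulgA.
  by rewrite hu hv !mulgA.
by apply/esym/sinv_uniq; apply: h.
Qed.

Lemma idemM e f : e * e = e -> f * f = f -> (e * f) * (e * f) = e * f.
Proof. exact: idem_mul. Qed.

Lemma dom_idem a : (a^-1 * a) * (a^-1 * a) = a^-1 * a.
Proof. by rewrite mulgA mulVsV. Qed.

Lemma rng_idem a : (a * a^-1) * (a * a^-1) = a * a^-1.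
Proof. by rewrite mulgA mulsVs. Qed.

Lemma sinvM a b : (a * b)^-1 = b^-1 * a^-1.
Proof.
have h (x y : S) : x * y * (y^-1 * x^-1) * (x * y) = x * y.
  have -> : x * y * (y^-1 * x^-1) * (x * y) = x * ((y * y^-1) * (x^-1 * x)) * y.
    by rewrite !mulgA.
  rewrite (idemC (rng_idem y) (dom_idem x)).
  have -> : x * (x^-1 * x * (y * y^-1)) * y = (x * x^-1 * x) * (y * y^-1 * y).
    by rewrite !mulgA.
  by rewrite !mulsVs.
by apply/esym/sinv_uniq; [|have := h b^-1 a^-1; rewrite !sinvK].
Qed.

Lemma conj_idem s e : e * e = e ->
  (s^-1 * e * s) * (s^-1 * e * s) = s^-1 * e * s.
Proof.
move=> he.
have -> : s^-1 * e * s * (s^-1 * e * s) = s^-1 * (e * (s * s^-1)) * e * s.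
  by rewrite !mulgA.
rewrite (idemC he (rng_idem s)).
have -> : s^-1 * (s * s^-1 * e) * e * s = (s^-1 * s * s^-1) * (e * e) * s.
  by rewrite !mulgA.
by rewrite mulVsV he.
Qed.

End InvSemigroupTheory.

Record idem (S : invSemigroupType) :=
  Idem { idem_val : S; idemP : idem_val * idem_val == idem_val }.

HB.instance Definition _ (S : invSemigroupType) :=
  [isSub for @idem_val S].
HB.instance Definition _ (S : invSemigroupType) := [Choice of idem S by <:].

Section Idem.
Variable S : invSemigroupType.
Implicit Types e f g : idem S.

Definition mk_idem (x : S) (h : x * x = x) : idem S := Idem (introT eqP h).

Lemma idem_valK e : val e * val e = val e.
Proof. exact/eqP/idemP. Qed.

Lemma valC e f : val e * val f = val f * val e.
Proof. by apply: idemC; exact: idem_valK. Qed.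

Definition idem0 : idem S := mk_idem (mul0s szero).
Definition idem_meet e f : idem S :=
  mk_idem (idemM (idem_valK e) (idem_valK f)).
Definition idem_le e f := idem_meet e f == e.

Lemma idem_meetC : commutative idem_meet.
Proof. by move=> e f; apply/val_inj; exact: valC. Qed.

Lemma idem_meetA : associative idem_meet.
Proof. by move=> e f g; apply/val_inj; exact: mulgA. Qed.

Lemma idem_meetxx : idempotent_op idem_meet.
Proof. by move=> e; apply/val_inj; exact: idem_valK. Qed.

Lemma idem_le_refl : reflexive idem_le.
Proof. by move=> e; rewrite /idem_le idem_meetxx. Qed.

Lemma idem_le_anti : antisymmetric idem_le.
Proof. by move=> e f /andP[/eqP ef /eqP fe]; rewrite -ef idem_meetC. Qed.

Lemma idem_le_trans : transitive idem_le.
Proof.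
by move=> f e g /eqP ef /eqP fg; apply/eqP; rewrite -{1}ef -idem_meetA fg.
Qed.

Lemma idem_le0x e : idem_le idem0 e.
Proof. by apply/eqP/val_inj; exact: mul0s. Qed.

Lemma idem_leEmeet e f : idem_le e f = (idem_meet e f == e).
Proof. by []. Qed.

End Idem.

Fact idem_display : Order.disp_t. Proof. exact: Order.Disp tt tt. Qed.

HB.instance Definition _ (S : invSemigroupType) :=
  Order.Le_isPOrder.Build idem_display (idem S)
    (@idem_le_refl S) (@idem_le_anti S) (@idem_le_trans S).
HB.instance Definition _ (S : invSemigroupType) :=
  Order.hasBottom.Build idem_display (idem S) (@idem_le0x S).
HB.instance Definition _ (S : invSemigroupType) :=
  Order.POrder_Meet_isSemilattice.Build idem_display (idem S)
    (@idem_meetC S) (@idem_meetA S) (@idem_leEmeet S).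

Section InvSemigroupDefs.
Variable S : invSemigroupType.
Implicit Types (a b s : S) (e : idem S).

Definition dom s : idem S := mk_idem (dom_idem s).
Definition rng s : idem S := mk_idem (rng_idem s).
Definition econj s e : idem S := mk_idem (conj_idem s (idem_valK e)).

Definition nle a b := exists e, a = b * val e.

Definition is_join (A : set S) a :=
  (forall x, A x -> nle x a) /\
  (forall b, (forall x, A x -> nle x b) -> nle a b).

Definition compatible a b :=
  (a^-1 * b) * (a^-1 * b) = a^-1 * b /\ (a * b^-1) * (a * b^-1) = a * b^-1.

End InvSemigroupDefs.

(* The fields on [idem S] are exactly what is needed for [idem S] to be a
   [cbDistrLatticeType], i.e. a generalized Boolean algebra, for the order
   [e <= f] iff [e * f = e]; the operations are determined by that order. *)
HB.mixin Record InvSemigroup_isBoolean S of InvSemigroup S := {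
  ejoin : idem S -> idem S -> idem S;
  ediff : idem S -> idem S -> idem S;
  ejoin_le : forall e f g : idem S, (ejoin e f <= g) = (e <= g) && (f <= g);
  emeetUl : left_distributive (@Order.meet _ (idem S)) ejoin;
  ediffKI : forall e f : idem S, f `&` ediff e f = \bot;
  ejoinIB : forall e f : idem S, ejoin (e `&` f) (ediff e f) = e;
  compatible_join : forall a b : S, compatible a b ->
    exists c, is_join [set a; b] c
}.

#[short(type="boolInvSemigroupType")]
HB.structure Definition BoolInvSemigroup :=
  {S of InvSemigroup_isBoolean S & InvSemigroup S}.

HB.instance Definition _ (S : boolInvSemigroupType) :=
  Order.POrder_isJoinSemilattice.Build idem_display (idem S) (@ejoin_le S).
HB.instance Definition _ (S : boolInvSemigroupType) :=
  Order.Lattice_Meet_isDistrLattice.Build idem_display (idem S) (@emeetUl S).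
HB.instance Definition _ (S : boolInvSemigroupType) :=
  Order.BDistrLattice_hasSectionalComplement.Build idem_display (idem S)
    (@ediffKI S) (@ejoinIB S).

Section SemilatticeRepresentations.
Context {d d' : Order.disp_t} {E : bMeetSemilatticeType d}
        {B : cbDistrLatticeType d'}.
Implicit Types (phi : E -> B) (X : set (E * {fset E})).

Record representation phi : Prop := {
  rep_bot : phi \bot = \bot;
  rep_meet : {morph phi : x y / x `&` y}
}.

Definition proper_map phi :=
  forall y : B, exists s : seq E, y <= \join_(x <- s) phi x.

Record to_join X phi : Prop := {
  tj_rep : representation phi;
  tj_proper : proper_map phi;
  tj_join : forall e (A : {fset E}), X (e, A) -> phi e = \join_(x <- A) phi x
}.

End SemilatticeRepresentations.

Record boolalg_morphism {d d' : Order.disp_t} {A : cbDistrLatticeType d}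
    {B : cbDistrLatticeType d'} (phi : A -> B) : Prop := {
  bam_bot : phi \bot = \bot;
  bam_join : {morph phi : x y / x `|` y};
  bam_meet : {morph phi : x y / x `&` y};
  bam_diff : {morph phi : x y / x `\` y};
  bam_proper : proper_map phi
}.

(* [bool], with [\bot = false] and meet [&&], is the Boolean algebra {0, 1};
   a map into it is proper iff it is non-zero. *)
Definition character {d : Order.disp_t} {E : bMeetSemilatticeType d}
    (phi : E -> bool) :=
  representation phi /\ exists e, phi e.

Section Restriction.
Context {S T : invSemigroupType} (phi : S -> T).

Definition semigroup_morphism := {morph phi : a b / a * b}.

Lemma erestr_subproof (phiM : semigroup_morphism) (e : idem S) :
  phi (val e) * phi (val e) = phi (val e).
Proof. by rewrite -phiM idem_valK. Qed.

Definition erestr (phiM : semigroup_morphism) (e : idem S) : idem T :=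
  mk_idem (erestr_subproof phiM e).

End Restriction.

Section Representations.
Context {S : invSemigroupType} {T : boolInvSemigroupType}.
Implicit Types (X : set (idem S * {fset idem S})) (phi : S -> T).

(* An X-to-join map of semilattices is in particular a proper representation,
   so that [erestr phiM] being X-to-join makes [phi] a representation. *)
Definition to_join_representation X phi :=
  exists phiM : semigroup_morphism phi, to_join X (erestr phiM).

Definition is_proper phi :=
  forall t : T, exists (n : nat) (u : 'I_n.+1 -> T) (s : 'I_n.+1 -> S),
    is_join (range u) t /\ forall i, nle (u i) (phi (s i)).

End Representations.

Record bis_morphism {S T : boolInvSemigroupType} (psi : S -> T) : Prop := {
  bm_mul : semigroup_morphism psi;
  bm_restr : boolalg_morphism (erestr bm_mul);
  bm_join : forall a b c, compatible a b -> is_join [set a; b] c ->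
    is_join [set psi a; psi b] (psi c)
}.

Section Invariant.
Variable S : invSemigroupType.
Implicit Types X : set (idem S * {fset idem S}).

Definition S_invariant X := forall e (A : {fset idem S}), X (e, A) ->
  forall s : S, X (econj s e, [fset econj s x | x in A]%fset).

Definition invariant_closure X := smallest S_invariant X.

Lemma invariant_closureP X : S_invariant (invariant_closure X).
Proof.
by move=> e A eA s Y [Yinv XY]; apply: (Yinv) => //; apply: eA.
Qed.

End Invariant.

Section Germs.
Variables (S : invSemigroupType) (X : set (idem S * {fset idem S})).
Implicit Types (s t : S) (e f : idem S).

(* The [X']-to-join characters, where [X'] is the smallest S-invariant set
   containing [X]. *)
Record xchar := XChar {
  xchar_fun :> idem S -> bool;
  xchar_character : character xchar_fun;
  xchar_to_join : to_join (invariant_closure X) xchar_fun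
}.

Lemma xchar_eq (p q : xchar) : p =1 q -> p = q.
Proof.
case: p q => [p p1 p2] [q q1 q2] /= /funext pq.
by subst q; congr XChar; exact: Prop_irrelevance.
Qed.

(* A pair (s, phi) such that phi belongs to the domain of s. *)
Record pregerm := PreGerm {
  pg_elt : S;
  pg_chr : xchar;
  pg_dom : pg_chr (dom pg_elt)
}.

Lemma pregerm_eq p q : pg_elt p = pg_elt q -> pg_chr p = pg_chr q -> p = q.
Proof.
case: p q => [s p h] [t q k] /= st pq.
by subst t q; congr PreGerm; exact: Prop_irrelevance.
Qed.

HB.instance Definition _ := gen_eqMixin pregerm.
HB.instance Definition _ := gen_choiceMixin pregerm.

Lemma xcharI (p : xchar) e f : p (e `&` f) = p e && p f.
Proof. by have [[_ pI] _ _] := xchar_to_join p; rewrite pI. Qed.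

Lemma xchar0 (p : xchar) : p \bot = false.
Proof. by have [[p0 _] _ _] := xchar_to_join p; rewrite p0. Qed.

Lemma xchar_le (p : xchar) e f : e <= f -> p e -> p f.
Proof. by move=> /meet_idPl <-; rewrite xcharI => /andP[]. Qed.

Section Action.
Variable p : pregerm.
Let s := pg_elt p.
Let phi := pg_chr p.

(* For [p = (s, phi)], the character [s . phi]; [s] acts only on the [phi] with
   [phi (dom s)], which is why [act] takes a pregerm. *)
Definition act_fun e : bool := phi (econj s e).

Lemma econjI (r : S) e f : econj r (e `&` f) = econj r e `&` econj r f.
Proof.
apply/val_inj => /=.
have -> : r^-1 * val e * r * (r^-1 * val f * r) =
  r^-1 * (val e * (r * r^-1)) * val f * r by rewrite !mulgA.
rewrite (idemC (idem_valK e) (rng_idem r)).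
have -> : r^-1 * (r * r^-1 * val e) * val f * r =
  (r^-1 * r * r^-1) * (val e * val f) * r by rewrite !mulgA.
by rewrite mulVsV.
Qed.

Lemma mul_econj (r : S) e : r * val (econj r e) = val e * r.
Proof.
by rewrite /= !mulgA (idemC (rng_idem r) (idem_valK e)) -mulgA mulsVs.
Qed.

Lemma econj0 (r : S) : econj r \bot = \bot :> idem S.
Proof. by apply/val_inj; rewrite /= muls0 mul0s. Qed.

Lemma econj_rng (r : S) : econj r (rng r) = dom r.
Proof. by apply/val_inj; rewrite /= !mulgA mulVsV. Qed.

Lemma act_rep : representation act_fun.
Proof.
split; first by rewrite /act_fun econj0 xchar0.
by move=> e f; rewrite /act_fun econjI xcharI.
Qed.

Lemma act_rng : act_fun (rng s).
Proof. by rewrite /act_fun econj_rng; exact: pg_dom. Qed.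

Lemma act_character : character act_fun.
Proof. by split; [exact: act_rep|exists (rng s); exact: act_rng]. Qed.

Lemma joinbE (I : eqType) (r : seq I) (F : I -> bool) :
  \join_(i <- r) F i = has F r.
Proof. by elim: r => [|i r IH]; rewrite ?big_nil ?big_cons //= IH. Qed.

Lemma act_to_join : to_join (invariant_closure X) act_fun.
Proof.
split; first exact: act_rep.
  by move=> y; exists [:: rng s]; rewrite big_seq1 act_rng; case: y.
move=> e A eA; rewrite /act_fun.
have [_ _ /(_ _ _ (invariant_closureP eA s)) ->] := xchar_to_join phi.
rewrite !joinbE; apply/hasP/hasP => [[_ /imfsetP[x /= xA ->] h]|[x xA h]].
  by exists x.
by exists (econj s x) => //; apply/imfsetP; exists x.
Qed.

Definition act : xchar := XChar act_character act_to_join.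

End Action.

Definition germ_rel (p q : pregerm) : bool :=
  `[< pg_chr p = pg_chr q /\
      exists2 e, pg_chr p e & pg_elt p * val e = pg_elt q * val e >].

Lemma germ_rel_refl : reflexive germ_rel.
Proof. by move=> p; apply/asboolP; split=> //; exists (dom (pg_elt p)) => //; exact: pg_dom. Qed.

Lemma germ_rel_sym : symmetric germ_rel.
Proof.
have h p q : germ_rel p q -> germ_rel q p.
  by move=> /asboolP[pq [e pe eq]]; apply/asboolP; split=> //; exists e; rewrite -?pq.
by move=> p q; apply/idP/idP; exact: h.
Qed.

Lemma germ_rel_trans : transitive germ_rel.
Proof.
move=> q p r /asboolP[pq [e pe epq]] /asboolP[qr [f qf fqr]]; apply/asboolP.
split; first by rewrite pq.
exists (e `&` f); first by rewrite xcharI pe pq.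
by rewrite /= mulgA epq -mulgA valC mulgA fqr -mulgA.
Qed.

Canonical germ_equiv :=
  EquivRel germ_rel germ_rel_refl germ_rel_sym germ_rel_trans.

(* [pgerm p] is the germ [s, phi] of the pair [p = (s, phi)]. *)
Definition germ := {eq_quot germ_rel}%qT.

HB.instance Definition _ := Choice.on germ.

Definition pgerm (p : pregerm) : germ := (\pi_{eq_quot germ_rel} p)%qT.

Lemma pgermP p q : pgerm p = pgerm q <->
  pg_chr p = pg_chr q /\
  exists2 e, pg_chr p e & pg_elt p * val e = pg_elt q * val e.
Proof.
split=> [h|h]; first by apply/asboolP; have /eqmodP := h.
by apply/eqmodP/asboolP.
Qed.

Lemma pgerm_repr (g : germ) : pgerm (repr g) = g.
Proof. exact: reprK. Qed.

Lemma act_pgerm p q : pgerm p = pgerm q -> act p = act q.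
Proof.
move=> /pgermP[pq [e pe eq]]; apply: xchar_eq => f.
rewrite /= /act_fun.
have h (r : pregerm) : pg_chr r e ->
  pg_chr r (econj (pg_elt r) f) = pg_chr r (econj (pg_elt r * val e) f).
  move=> re; have -> : econj (pg_elt r * val e) f = e `&` econj (pg_elt r) f `&` e.
    by apply/val_inj; rewrite /= sinvM (idem_inv (idem_valK e)) !mulgA.
  by rewrite !xcharI re andbT.
by rewrite h // eq [RHS]h -pq.
Qed.

Definition src (g : germ) : xchar := pg_chr (repr g).
Definition tgt (g : germ) : xchar := act (repr g).

Lemma srcE p : src (pgerm p) = pg_chr p.
Proof. by have /pgermP[] := pgerm_repr (pgerm p). Qed.

Lemma tgtE p : tgt (pgerm p) = act p.
Proof. exact/act_pgerm/pgerm_repr. Qed.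

Lemma pmul_subproof p q : pg_chr p = act q -> pg_chr q (dom (pg_elt p * pg_elt q)).
Proof.
move=> pq; have := pg_dom p; rewrite pq /= /act_fun.
by congr (is_true (pg_chr q _)); apply/val_inj; rewrite /= sinvM !mulgA.
Qed.

(* For [q = (t, phi)] and [p = (s, t . phi)], this is [(s t, phi)]. *)
Definition pmul p q (pq : pg_chr p = act q) : pregerm :=
  PreGerm (pmul_subproof pq).

Lemma pinv_subproof p : act p (dom (pg_elt p)^-1).
Proof.
suff -> : dom (pg_elt p)^-1 = rng (pg_elt p) by exact: act_rng.
by apply/val_inj; rewrite /= sinvK.
Qed.

(* For [p = (s, phi)], this is [(s^-1, s . phi)]. *)
Definition pinv p : pregerm := PreGerm (pinv_subproof p).

(* Composition is computed on representatives; see [gmulE] for independence. *)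
Definition gmul (g h : germ) (gh : src g = tgt h) : germ := pgerm (pmul gh).
Definition ginv (g : germ) : germ := pgerm (pinv (repr g)).

Lemma gmulE p q (pq : pg_chr p = act q) gh :
  @gmul (pgerm p) (pgerm q) gh = pgerm (pmul pq).
Proof.
have /pgermP[_ [e pe ep]] := pgerm_repr (pgerm p).
have /pgermP[h2 [f pf fp]] := pgerm_repr (pgerm q).
apply/pgermP; split=> //=.
set q' := repr (pgerm q) in pe ep gh h2 pf fp *.
set p' := repr (pgerm p) in pe ep gh h2 pf fp *.
have pe' : pg_chr q' (econj (pg_elt q') e) by have := pe; rewrite -/p' [pg_chr p']gh.
exists (f `&` econj (pg_elt q') e); first by rewrite xcharI pf.
have fc : val (f `&` econj (pg_elt q') e) = val (econj (pg_elt q') e) * val f.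
  exact: valC.
set k := econj (pg_elt q') e in pe' fc *.
have key' : pg_elt q' * val k = val e * pg_elt q' by exact: mul_econj.
clearbody k; rewrite fc.
have -> : pg_elt p * pg_elt q * (val k * val f) =
  pg_elt p * (pg_elt q * val f) * val k by rewrite -fc /= !mulgA.
rewrite -fp.
have -> : pg_elt p * (pg_elt q' * val f) * val k =
  pg_elt p * (pg_elt q' * val k) * val f.
  by rewrite -!mulgA -[val f * val k]/(val (f `&` k)) fc.
by rewrite mulgA -(mulgA (pg_elt p')) key' mulgA ep -!mulgA (mulgA (val e)) -key' !mulgA.
Qed.

End Germs.

Arguments src {S X} g.
Arguments tgt {S X} g.
Arguments ginv {S X} g.
Arguments pgerm {S X} p.
Arguments act {S X} p.

Local Open Scope classical_set_scope.

Section GermTheory.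
Variables (S : invSemigroupType) (X : set (idem S * {fset idem S})).
Local Notation germ := (germ X).
Local Notation pregerm := (pregerm X).
Implicit Types (s t : S) (e f : idem S) (p q r : pregerm) (g h k : germ).

Lemma pmul_congr p p' q q' (c : pg_chr p = act q) (c' : pg_chr p' = act q') :
  pgerm p = pgerm p' -> pgerm q = pgerm q' ->
  pgerm (pmul c) = pgerm (pmul c').
Proof.
move=> pp' qq'; have gh : src (pgerm p) = tgt (pgerm q) by rewrite srcE tgtE.
rewrite -(gmulE c gh); move: gh; rewrite pp' qq' => gh.
by rewrite (gmulE c' gh).
Qed.

Lemma act_pmul p q (c : pg_chr p = act q) : act (pmul c) = act p.
Proof.
apply: xchar_eq => e; rewrite /= /act_fun c /= /act_fun; congr (pg_chr q _).
by apply/val_inj; rewrite /= sinvM !mulgA.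
Qed.

Lemma act_pinv p : act (pinv p) = pg_chr p.
Proof.
apply: xchar_eq => e; rewrite /= /act_fun /= /act_fun.
have -> : econj (pg_elt p) (econj (pg_elt p)^-1 e) =
    (dom (pg_elt p) `&` e `&` dom (pg_elt p))%O.
  by apply/val_inj; rewrite /= sinvK !mulgA.
by rewrite !xcharI pg_dom andbT.
Qed.

Lemma pinvK p : pinv (pinv p) = p.
Proof. by apply: pregerm_eq; rewrite /= ?sinvK ?act_pinv. Qed.

Lemma pinv_congr p q : pgerm p = pgerm q -> pgerm (pinv p) = pgerm (pinv q).
Proof.
move=> pq; have /pgermP[pqc [e pe eq]] := pq.
apply/pgermP; split; first exact: act_pgerm pq.
exists (econj (pg_elt p)^-1 e).
  rewrite /= /act_fun.
  have -> : econj (pg_elt p) (econj (pg_elt p)^-1 e) =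
      (dom (pg_elt p) `&` e `&` dom (pg_elt p))%O.
    by apply/val_inj; rewrite /= sinvK !mulgA.
  by rewrite !xcharI pg_dom andbT.
have key (a : S) : a * val e * a^-1 = (a * val e) * (a * val e)^-1.
  by rewrite sinvM (idem_inv (idem_valK e)) mulgA -(mulgA a (val e) (val e)) idem_valK.
have key2 (a : S) : a^-1 * (a * val e * a^-1) = (a * val e)^-1.
  rewrite sinvM (idem_inv (idem_valK e)) !mulgA.
  by rewrite (idemC (dom_idem a) (idem_valK e)) -mulgA mulVsV.
rewrite /= sinvK key2 key eq -key key2.
by rewrite -eq.
Qed.

Lemma ginvE p : ginv (pgerm p) = pgerm (pinv p).
Proof. exact/pinv_congr/pgerm_repr. Qed.

Lemma ginvK g : ginv (ginv g) = g.
Proof. by rewrite -(pgerm_repr g) !ginvE pinvK. Qed.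

Lemma src_ginv g : src (ginv g) = tgt g.
Proof. by rewrite -(pgerm_repr g) ginvE srcE tgtE. Qed.

Lemma tgt_ginv g : tgt (ginv g) = src g.
Proof. by rewrite -(pgerm_repr g) ginvE srcE tgtE act_pinv. Qed.

Lemma dom_mul s e : dom (s * val e) = (dom s `&` e)%O.
Proof.
apply/val_inj; transitivity (val e * val (dom s) * val e).
  by rewrite /= sinvM (idem_inv (idem_valK e)) !mulgA.
by rewrite valC -mulgA idem_valK.
Qed.

Lemma pgerm_res p e : pg_chr p e ->
  exists q, [/\ pg_elt q = pg_elt p * val e, pg_chr q = pg_chr p
               & pgerm q = pgerm p].
Proof.
move=> pe; have dq : pg_chr p (dom (pg_elt p * val e)).
  by rewrite dom_mul xcharI pe pg_dom.
exists (PreGerm dq); split=> //; apply/pgermP; split=> //.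
by exists e => //=; rewrite -mulgA idem_valK.
Qed.

Lemma pgerm_ext p s e : pg_elt p = s * val e ->
  exists q, [/\ pg_elt q = s, pg_chr q = pg_chr p,
               pgerm q = pgerm p & pg_chr p e].
Proof.
move=> pse; have := pg_dom p.
rewrite pse dom_mul xcharI => /andP[ps pe]; exists (PreGerm ps); split=> //.
by apply/pgermP; split=> //; exists e => //=; rewrite pse -mulgA idem_valK.
Qed.

Definition basic s (l : seq S) : set germ :=
  [set g | exists p, [/\ pg_elt p = s, g = pgerm p
                       & forall t, t \in l -> ~~ pg_chr p (dom t)]].

Definition basis : set (set germ) :=
  [set U | exists s (l : seq S),
    (forall t, t \in l -> nle t s) /\ U = basic s l].

(* The same sets, with zero conditions indexed by arbitrary idempotents. *)
Definition cyl s (l : seq (idem S)) : set germ :=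
  [set g | exists p, [/\ pg_elt p = s, g = pgerm p
                       & forall e, e \in l -> ~~ pg_chr p e]].

Lemma basic_cyl s (l : seq S) : basic s l = cyl s [seq dom t | t <- l].
Proof.
apply/seteqP; split=> g [p [ps gp pl]]; exists p; split=> //.
  by move=> _ /mapP[t tl ->]; exact: pl.
by move=> t tl; apply: pl; apply/mapP; exists t.
Qed.

Lemma basis_cyl s (l : seq (idem S)) : basis (cyl s l).
Proof.
exists s, [seq s * val e | e <- l]; split.
  by move=> _ /mapP[e _ ->]; exists e.
have h p e : pg_elt p = s -> pg_chr p (dom (s * val e)) = pg_chr p e.
  by move=> <-; rewrite dom_mul xcharI pg_dom.
apply/seteqP; split=> g [p [ps gp pl]]; exists p; split=> //.
  by move=> _ /mapP[e el ->]; rewrite h // pl.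
by move=> e el; rewrite -(h _ _ ps); apply: pl; apply/mapP; exists e.
Qed.

Lemma cyl_point g : exists p, g = pgerm p.
Proof. by exists (repr g); rewrite pgerm_repr. Qed.

Lemma basis_cover : \bigcup_(U in basis) U = setT.
Proof.
apply/seteqP; split=> // g _; have [p ->] := cyl_point g.
by exists (cyl (pg_elt p) [::]); [exact: basis_cyl|exists p].
Qed.

Lemma basis_join (U V : set germ) g : basis U -> basis V -> U g -> V g ->
  exists W, [/\ basis W, W g & W `<=` U `&` V].
Proof.
move=> [s [l [_ ->]]] [t [m [_ ->]]]; rewrite !basic_cyl.
set l' := map _ l; set m' := map _ m.
move=> [p [ps gp pl]] [q [qt gq qm]].
have /pgermP[pq [e pe eq]] : pgerm p = pgerm q by rewrite -gp.
exists (cyl (s * val e) (l' ++ m')); split; first exact: basis_cyl.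
  have [r [re rp rg]] := pgerm_res pe; exists r; split.
  - by rewrite re ps.
  - by rewrite gp rg.
  - by move=> f; rewrite rp mem_cat => /orP[/pl//|/qm]; rewrite pq.
move=> h [r [rse hr rlm]]; split.
  have [r' [r's r'r r'g _]] := pgerm_ext rse.
  exists r'; split=> //; first by rewrite hr r'g.
  by move=> f fl; rewrite r'r rlm // mem_cat fl.
have rte : pg_elt r = t * val e by rewrite rse -ps eq qt.
have [r' [r's r'r r'g _]] := pgerm_ext rte.
exists r'; split=> //; first by rewrite hr r'g.
by move=> f fl; rewrite r'r rlm // mem_cat fl orbT.
Qed.

HB.instance Definition _ := @isBaseTopological.Build germ
  (set germ) basis id basis_cover basis_join.

Lemma open_cyl s (l : seq (idem S)) : open (cyl s l).
Proof.
by exists [set cyl s l]; [move=> _ ->; exact: basis_cyl|rewrite bigcup_set1].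
Qed.

Lemma nbhs_germP g (A : set germ) : nbhs g A <->
  exists p (l : seq (idem S)), [/\ g = pgerm p,
    (forall e, e \in l -> ~~ pg_chr p e) & cyl (pg_elt p) l `<=` A].
Proof.
split=> [|[p [l [gp pl sA]]]]; last first.
  apply: (filterS sA); apply: open_nbhs_nbhs; split; first exact: open_cyl.
  by exists p.
rewrite nbhsE => -[U [[D sD <-] [V DV Vg]] sA].
have [s [l [_ VE]]] := sD _ DV.
move: Vg; rewrite VE basic_cyl => -[p [ps gp pl]].
exists p, [seq dom t | t <- l]; split=> //; rewrite ps.
by move=> h Vh; apply: sA; exists V => //; rewrite VE basic_cyl.
Qed.

Lemma near_src g e : nbhs g [set h | src h e = src g e].
Proof.
have [p ->] := cyl_point g; apply/nbhs_germP; rewrite srcE.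
case: (boolP (pg_chr p e)) => pe; last first.
  exists p, [:: e]; split=> // [f|_ [q [_ -> /(_ e)]]].
    by rewrite inE => /eqP ->.
  by rewrite /= srcE mem_seq1 eqxx => /(_ isT) /negbTE.
have [q [qe qp <-]] := pgerm_res pe; exists q, [::]; split=> //.
move=> _ [r [rq -> _]] /=; rewrite srcE.
by have [r' [_ _ _ ->]] := pgerm_ext (etrans rq qe).
Qed.

Lemma near_tgt g e : nbhs g [set h | tgt h e = tgt g e].
Proof.
have [p ->] := cyl_point g.
have hp : nbhs (pgerm p) (cyl (pg_elt p) [::]).
  by apply: open_nbhs_nbhs; split; [exact: open_cyl|exists p].
apply: filterS (filterI hp (near_src (pgerm p) (econj (pg_elt p) e))).
move=> h [[q [qp -> _]] E]; change (tgt (pgerm q) e = tgt (pgerm p) e).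
have {}E : src (pgerm q) (econj (pg_elt p) e) =
  src (pgerm p) (econj (pg_elt p) e) := E.
by move: E; rewrite !srcE !tgtE /= /act_fun qp.
Qed.

Lemma src_lim (F : set_system germ) g h : ProperFilter F ->
  cluster F h -> F --> g -> src g = src h.
Proof.
move=> FF Fh Fg; apply: xchar_eq => e.
by have [k [/= <- <-]] := Fh _ _ (Fg _ (near_src g e)) (near_src h e).
Qed.

Lemma near_mul g h (c : src g = tgt h) (A : set germ) : nbhs (gmul c) A ->
  exists U V, [/\ nbhs g U, nbhs h V & forall g' h' (c' : src g' = tgt h'),
    U g' -> V h' -> A (gmul c')].
Proof.
move: c; have [p ->] := cyl_point g; have [q ->] := cyl_point h.
move=> c; have pq : pg_chr p = act q by rewrite -srcE c tgtE.
rewrite (gmulE pq c) => /nbhs_germP[w [l [/pgermP[pqw [e /= qe we]] wl sA]]].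
have [q1 [q1e q1q q1g]] := pgerm_res qe.
exists (cyl (pg_elt p) [::]), (cyl (pg_elt q * val e) l); split.
- by apply: open_nbhs_nbhs; split; [exact: open_cyl|exists p].
- apply: open_nbhs_nbhs; split; first exact: open_cyl.
  by exists q1; split=> // f fl; rewrite q1q [pg_chr q]pqw wl.
move=> g' h' c' [p' [p's gp' _]] [q' [q's hq' q'l]]; subst g' h'.
have pq' : pg_chr p' = act q' by rewrite -srcE c' tgtE.
rewrite (gmulE pq' c'); apply: sA.
have : pg_elt (pmul pq') = pg_elt w * val e by rewrite /= p's q's mulgA.
by move=> /pgerm_ext[r [rw rq' <- _]]; exists r; split=> // f fl; rewrite rq' q'l.
Qed.

Lemma near_inv g (A : set germ) : nbhs (ginv g) A -> nbhs g (ginv @^-1` A).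
Proof.
have [p ->] := cyl_point g; rewrite ginvE => /nbhs_germP[w [l [wp wl sA]]].
apply/nbhs_germP; exists (pinv w), [seq econj (pg_elt w)^-1 e | e <- l]; split.
- by rewrite -(pinv_congr wp) pinvK.
- move=> _ /mapP[e el ->]; rewrite -[_ (econj _ _)]/(act (pinv w) e).
  by rewrite act_pinv wl.
move=> _ [q [qw -> ql]]; rewrite /= ginvE; apply: sA; exists (pinv q).
split=> // [|e el]; first by rewrite /= qw sinvK.
by rewrite /= /act_fun qw; apply: ql; exact: map_f.
Qed.

Definition bisection (U : set germ) := set_inj U src /\ set_inj U tgt.

Definition bmul (U V : set germ) : set germ :=
  [set k | exists g h (c : src g = tgt h), [/\ U g, V h & k = gmul c]].

Definition binv (U : set germ) : set germ := [set ginv g | g in U].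

(* [compact] does not include Hausdorff: the space of germs need not be. *)
Definition compact_open_bisection (U : set germ) :=
  [/\ compact U, open U & bisection U].

Implicit Types U V W : set germ.

Lemma bmulP U V k : bmul U V k <-> exists p q (c : pg_chr p = act q),
  [/\ U (pgerm p), V (pgerm q) & k = pgerm (pmul c)].
Proof.
split=> [[g [h [c [Ug Vh ->]]]]|[p [q [c [Up Vq ->]]]]].
  by exists (repr g), (repr h), c; rewrite !pgerm_repr.
have c' : src (pgerm p) = tgt (pgerm q) by rewrite srcE tgtE.
by exists (pgerm p), (pgerm q), c'; rewrite (gmulE c c').
Qed.

Lemma binvE U g : binv U g <-> U (ginv g).
Proof.
by split=> [[h Uh <-]|Ug]; [rewrite ginvK|exists (ginv g); rewrite ?ginvK].
Qed.

Lemma binvK U : binv (binv U) = U.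
Proof. by apply/seteqP; split=> g; rewrite !binvE ginvK. Qed.

Lemma bmulA U V W : bmul U (bmul V W) = bmul (bmul U V) W.
Proof.
apply/seteqP; split=> k /bmulP.
  move=> [p [r [c [Up /bmulP[q [w [c' [Vq Ww rE]]]] ->]]]].
  have cpq : pg_chr p = act q by rewrite c (act_pgerm rE) act_pmul.
  apply/bmulP; exists (pmul cpq), w, c'; split=> //.
    by apply/bmulP; exists p, q, cpq.
  have cpr : pg_chr p = act (pmul c') by rewrite act_pmul.
  rewrite (pmul_congr c cpr erefl rE); congr pgerm.
  by apply: pregerm_eq => //=; rewrite mulgA.
move=> [r [w [c [/bmulP[p [q [c' [Up Vq rE]]]] Ww ->]]]].
have cqw : pg_chr q = act w.
  by have /pgermP[<- _] := rE.
have cpr : pg_chr p = act (pmul cqw) by rewrite act_pmul.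
apply/bmulP; exists p, (pmul cqw), cpr; split=> //.
  by apply/bmulP; exists q, w, cqw.
have c2 : pg_chr (pmul c') = act w by [].
rewrite (pmul_congr c c2 rE erefl); congr pgerm.
by apply: pregerm_eq => //=; rewrite mulgA.
Qed.

Lemma bmulVK U V : bisection V -> U `<=` V -> bmul (bmul V (binv U)) U = U.
Proof.
move=> [Vs Vt] UV; apply/seteqP; split=> k.
  move=> /bmulP[w [r [c [/bmulP[p [q [c' [Vp /binvE Uq wE]]]] Ur ->]]]].
  move: Uq; rewrite ginvE => Uq.
  have cqr : pg_chr q = act r by have /pgermP[<- _] := wE.
  have qr : pgerm (pinv q) = pgerm r.
    by apply: Vt; rewrite ?inE; [exact: UV|exact: UV|rewrite !tgtE act_pinv].
  have pr : pgerm p = pgerm r.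
    apply: Vs; rewrite ?inE //; first exact: UV.
    by rewrite -qr !srcE c'.
  have rq : pgerm q = pgerm (pinv r) by rewrite -(pinv_congr qr) pinvK.
  have c1 : pg_chr r = act (pinv r) by rewrite act_pinv.
  have c2 : pg_chr (pmul c1) = act r by [].
  suff -> : pgerm (pmul c) = pgerm r by [].
  have wE2 : pgerm w = pgerm (pmul c1) by rewrite wE; exact: pmul_congr.
  rewrite (pmul_congr c c2 wE2 erefl); congr pgerm.
  by apply: pregerm_eq => //=; rewrite mulsVs.
have [p ->] := cyl_point k => Up.
have c1 : pg_chr p = act (pinv p) by rewrite act_pinv.
have c2 : pg_chr (pmul c1) = act p by [].
apply/bmulP; exists (pmul c1), p, c2; split=> //.
  apply/bmulP; exists p, (pinv p), c1; split=> //; first exact: UV.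
  by apply/binvE; rewrite ginvE pinvK.
by congr pgerm; apply: pregerm_eq => //=; rewrite mulsVs.
Qed.

Definition is_unit g := exists2 p, pg_elt p * pg_elt p = pg_elt p & g = pgerm p.

Lemma unit_act p : pg_elt p * pg_elt p = pg_elt p -> act p = pg_chr p.
Proof.
move=> pp; apply: xchar_eq => e; rewrite /= /act_fun.
have -> : econj (pg_elt p) e = (dom (pg_elt p) `&` e `&` dom (pg_elt p))%O.
  by apply/val_inj; rewrite /= (idem_inv pp) pp.
by rewrite !xcharI pg_dom andbT.
Qed.

Lemma unit_tgt g : is_unit g -> tgt g = src g.
Proof. by move=> [p pp ->]; rewrite tgtE srcE unit_act. Qed.

Lemma unit_inj g h : is_unit g -> is_unit h -> src g = src h -> g = h.
Proof.
move=> [p pp ->] [q qq ->]; rewrite !srcE => pq; apply/pgermP; split=> //.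
exists (dom (pg_elt p) `&` dom (pg_elt q))%O.
  by rewrite xcharI pg_dom pq pg_dom.
rewrite /= (idem_inv pp) (idem_inv qq) pp qq mulgA pp.
by rewrite (idemC pp qq) mulgA qq.
Qed.

Lemma unit_mulr g h (c : src g = tgt h) : is_unit h -> gmul c = g.
Proof.
move=> [q qq hq]; subst h; move: c; have [p ->] := cyl_point g => c.
have pq : pg_chr p = act q by rewrite -srcE c tgtE.
rewrite (gmulE pq); apply/pgermP; split; first by rewrite /= pq unit_act.
exists (dom (pg_elt q)); first exact: pg_dom.
by rewrite /= (idem_inv qq) qq -mulgA qq.
Qed.

Lemma unit_mull g h (c : src g = tgt h) : is_unit g -> gmul c = h.
Proof.
move=> [p pp gp]; subst g; move: c; have [q ->] := cyl_point h => c.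
have pq : pg_chr p = act q by rewrite -srcE c tgtE.
rewrite (gmulE pq); apply/pgermP; split=> //.
pose i := mk_idem pp; exists (econj (pg_elt q) i).
  have := pg_dom p; rewrite pq /= /act_fun.
  by congr (is_true (pg_chr q _)); apply/val_inj; rewrite /= (idem_inv pp) pp.
have key : pg_elt q * val (econj (pg_elt q) i) = pg_elt p * pg_elt q.
  exact: mul_econj.
by rewrite -[LHS]mulgA key mulgA pp.
Qed.

Lemma bmul_units U V : U `<=` is_unit -> V `<=` is_unit -> bmul U V = U `&` V.
Proof.
move=> Uu Vu; apply/seteqP; split=> k.
  move=> [g [h [c [Ug Vh ->]]]].
  have gh : g = h by apply: unit_inj; [exact: Uu|exact: Vu|rewrite c unit_tgt //; exact: Vu].
  by rewrite (unit_mull c (Uu _ Ug)); split=> //; rewrite -gh.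
move=> [Uk Vk]; have c : src k = tgt k by rewrite unit_tgt //; exact: Uu.
by exists k, k, c; split=> //; rewrite unit_mull //; exact: Uu.
Qed.

Lemma units_bisection U : U `<=` is_unit -> bisection U.
Proof.
move=> Uu; split=> g h; rewrite !inE => /Uu gu /Uu hu.
  exact: unit_inj.
by rewrite !unit_tgt //; exact: unit_inj.
Qed.

Lemma src_gmul g h (c : src g = tgt h) : src (gmul c) = src h.
Proof. by rewrite srcE. Qed.

Lemma tgt_gmul g h (c : src g = tgt h) : tgt (gmul c) = tgt g.
Proof. by rewrite tgtE act_pmul. Qed.

Lemma bisection_idem U : bisection U -> bmul U U = U -> U `<=` is_unit.
Proof.
move=> [Us Ut] UU k Uk; have := Uk; rewrite -{1}UU => -[g [h [c [Ug Uh kE]]]].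
have kh : k = h by apply: Us; rewrite ?inE // kE src_gmul.
have kg : k = g by apply: Ut; rewrite ?inE // kE tgt_gmul.
subst h; subst g; move: c kE {Us Ut Uk Ug Uh}; have [p ->] := cyl_point k => c.
have pp : pg_chr p = act p by rewrite -srcE c tgtE.
rewrite (gmulE pp) => /pgermP[_ [e /= pe eq]].
set s := pg_elt p in eq *; pose f := econj s (dom s).
have pf : pg_chr p f by rewrite -[pg_chr p f]/(act p (dom s)) -pp; exact: pg_dom.
have pd : pg_chr p (dom (val (dom s))).
  have -> : dom (val (dom s)) = dom s.
    by apply/val_inj; rewrite [LHS]/= (idem_inv (dom_idem s)) dom_idem.
  exact: pg_dom.
exists (PreGerm pd); first exact: dom_idem.
apply/pgermP; split=> //; exists (f `&` e)%O; first by rewrite xcharI pf.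
have key : s * val f = val (dom s) * s.
  exact: mul_econj.
have fe : s * val (f `&` e)%O = val (dom s) * val e.
  rewrite -[LHS]/(s * (val f * val e)) mulgA key -mulgA [val (dom s)]/=.
  by rewrite -!(mulgA s^-1 s) (mulgA s s) -eq.
have E : val e * val (f `&` e)%O = val (f `&` e)%O.
  by rewrite -[val (f `&` e)%O]/(val f * val e) (valC f) mulgA idem_valK.
rewrite [pg_elt (PreGerm _)]/= -[s^-1 * s]/(val (dom s)) -/s.
by rewrite -[X in s * X](idem_valK (f `&` e)%O) mulgA fe -mulgA E.
Qed.

Lemma unit_div_inj U V : bmul U (binv V) `<=` is_unit ->
  forall g h, U g -> V h -> src g = src h -> g = h.
Proof.
move=> UVu g h; have [p ->] := cyl_point g; have [q ->] := cyl_point h.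
move=> Up Vq; rewrite !srcE => pq.
have c : pg_chr p = act (pinv q) by rewrite act_pinv.
have [|w ww /pgermP[/= cw [e qe we]]] := UVu (pgerm (pmul c)).
  by apply/bmulP; exists p, (pinv q), c; split=> //; apply/binvE; rewrite ginvE pinvK.
set s := pg_elt p in we *; set t := pg_elt q in we qe cw *.
pose i := mk_idem ww; apply/pgermP; split=> //.
have qi : act q i.
  rewrite [act q]cw; have := pg_dom w; congr (is_true (pg_chr w _)).
  by apply/val_inj; rewrite /= (idem_inv ww) ww.
exists (econj t (i `&` e)%O).
  by rewrite pq -[pg_chr q _]/(act q (i `&` e)%O) xcharI qi.
have -> : s * val (econj t (i `&` e)%O) = s * t^-1 * val e * val i * t.
  transitivity (s * t^-1 * (val i * val e) * t); first by rewrite /= !mulgA.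
  by rewrite valC !mulgA.
rewrite mul_econj we -[pg_elt w]/(val i) -[val (i `&` e)%O]/(val i * val e).
by rewrite (valC i e) -(mulgA (val e)) idem_valK.
Qed.

Lemma bisection_bmul U V : bisection U -> bisection V -> bisection (bmul U V).
Proof.
move=> [Us Ut] [Vs Vt]; split=> k k'; rewrite !inE;
  move=> [g [h [c [Ug Vh ->]]]] [g' [h' [c' [Ug' Vh' ->]]]].
  rewrite !src_gmul => hh'; have E : h = h' by apply: Vs; rewrite ?inE.
  have E' : g = g' by apply: Us; rewrite ?inE // c E.
  by subst g' h'; congr gmul; exact: Prop_irrelevance.
rewrite !tgt_gmul => gg'; have E : g = g' by apply: Ut; rewrite ?inE.
have E' : h = h' by apply: Vt; rewrite ?inE // -c E.
by subst g' h'; congr gmul; exact: Prop_irrelevance.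
Qed.

Lemma open_bmul U V : open U -> open V -> open (bmul U V).
Proof.
rewrite !openE => oU oV k /bmulP[p [q [c [Up Vq ->]]]].
have /nbhs_germP[p1 [l [pp1 p1l sU]]] := oU _ Up.
have /nbhs_germP[q1 [m [qq1 q1m sV]]] := oV _ Vq.
have c1 : pg_chr p1 = act q1.
  by have /pgermP[<- _] := pp1; rewrite c; exact: act_pgerm.
apply/nbhs_germP; exists (pmul c1), ([seq econj (pg_elt q1) e | e <- l] ++ m).
split; first exact: pmul_congr.
  move=> e; rewrite mem_cat => /orP[/mapP[f fl ->]|/q1m//].
  by rewrite -[_ (econj _ _)]/(act q1 f) -c1 p1l.
move=> _ [r [rst -> rlm]]; set s := pg_elt p1 in sU rst *.
set t := pg_elt q1 in sV rlm rst *; have rd := pg_dom r.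
have dE : dom (pg_elt r) = econj t (dom s).
  by apply/val_inj; rewrite /= rst /= sinvM !mulgA.
have rt : pg_chr r (dom t).
  move: rd; rewrite dE; apply: xchar_le; apply/meet_idPl/val_inj.
  by rewrite /= -!mulgA (mulgA t) mulsVs.
pose q2 := PreGerm rt; have p2d : act q2 (dom s) by rewrite /= /act_fun -dE.
pose p2 := PreGerm p2d; have c2 : pg_chr p2 = act q2 by [].
apply/bmulP; exists p2, q2, c2; split.
- apply: sU; exists p2; split=> // e el.
  by apply: rlm; rewrite mem_cat map_f.
- by apply: sV; exists q2; split=> // e el; apply: rlm; rewrite mem_cat el orbT.
- by congr pgerm; apply: pregerm_eq.
Qed.

Lemma ultra_fmap (T T' : Type) (f : T -> T') (F : set_system T) :
  UltraFilter F -> UltraFilter (f @ F).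
Proof.
move=> FU; split; first exact: fmap_proper_filter.
move=> G GF sFG; apply/seteqP; split=> [A GA|]; last exact: sFG.
have [//|FA] := in_ultra_setVsetC (f @^-1` A) FU.
have GA' : G (~` A) by apply: sFG.
by have /filter_ex[? []] : G (A `&` ~` A) by exact: filterI.
Qed.

Lemma compact_bmul U V : compact U -> compact V -> compact (bmul U V).
Proof.
rewrite !compact_ultra => cU cV F FU FUV.
have /choice[pr prP] : forall k, exists gh : germ * germ, bmul U V k ->
    exists c : src gh.1 = tgt gh.2, [/\ U gh.1, V gh.2 & k = gmul c].
  move=> k; have [[g [h [c H]]]|nk] := pselect (bmul U V k); last by exists (k, k).
  by exists (g, h) => _; exists c.
pose p1 := fst \o pr; pose p2 := snd \o pr.
have [|g [Ug Fg]] := cU (p1 @ F) (ultra_fmap _ FU).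
  suff : F (p1 @^-1` U) by []; apply: filterS FUV => k /prP[c [Uk Vk _]].
  exact: Uk.
have [|h [Vh Fh]] := cV (p2 @ F) (ultra_fmap _ FU).
  suff : F (p2 @^-1` V) by []; apply: filterS FUV => k /prP[c [Uk Vk _]].
  exact: Vk.
have c : src g = tgt h.
  apply: xchar_eq => e.
  have h1 : F (p1 @^-1` [set h | src h e = src g e]) by exact: Fg (near_src g e).
  have h2 : F (p2 @^-1` [set k | tgt k e = tgt h e]) by exact: Fh (near_tgt h e).
  have [k [/prP[c _] [/= <- <-]]] := filter_ex (filterI FUV (filterI h1 h2)).
  by rewrite /p1 /p2 /= c.
exists (gmul c); split; first by exists g, h, c.
move=> A /near_mul[U' [V' [gU' hV' sA]]].
have h1 : F (p1 @^-1` U') by exact: Fg.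
have h2 : F (p2 @^-1` V') by exact: Fh.
apply: filterS (filterI FUV (filterI h1 h2)) => k [/prP[c' [_ _ kE]] [/= U1 V1]].
by rewrite kE; exact: sA.
Qed.

Lemma cob_bmul U V : compact_open_bisection U -> compact_open_bisection V ->
  compact_open_bisection (bmul U V).
Proof.
move=> [cU oU bU] [cV oV bV].
by split; [exact: compact_bmul|exact: open_bmul|exact: bisection_bmul].
Qed.

Lemma cob_binv U : compact_open_bisection U -> compact_open_bisection (binv U).
Proof.
move=> [cU oU [Us Ut]]; split.
- move: cU; rewrite !compact_ultra => cU F FU FV.
  have [|g [Ug Fg]] := cU (ginv @ F) (ultra_fmap _ FU).
    suff : F (ginv @^-1` U) by []; by apply: filterS FV => k /binvE.
  exists (ginv g); split; first by exists g.
  move=> A /near_inv/Fg h.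
  have {h} : F (ginv @^-1` (ginv @^-1` A)) by [].
  suff -> : ginv @^-1` (ginv @^-1` A) = A by [].
  by apply/seteqP; split=> k /=; rewrite ginvK.
- move: oU; rewrite !openE => oU g /binvE /oU /near_inv.
  by apply: filterS => k /= Uk; apply/binvE.
- split=> g h; rewrite !inE !binvE => Ug Uh gh.
    by apply: (can_inj ginvK); apply: Ut; rewrite ?inE // !tgt_ginv.
  by apply: (can_inj ginvK); apply: Us; rewrite ?inE // !src_ginv.
Qed.

Lemma cob0 : compact_open_bisection set0.
Proof.
by split; [exact: compact0|exact: open0|split=> g h; rewrite inE].
Qed.

Lemma cob_setU U V : compact_open_bisection U -> compact_open_bisection V ->
  bisection (U `|` V) -> compact_open_bisection (U `|` V).
Proof.
by move=> [cU oU _] [cV oV _]; split=> //; [exact: compactU|exact: openU].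
Qed.

Lemma cob_setD U V : U `<=` is_unit -> V `<=` is_unit ->
  compact_open_bisection U -> compact_open_bisection V ->
  compact_open_bisection (U `\` V).
Proof.
move=> Uu Vu [cU oU _] [cV oV _]; split.
- by rewrite setDE; apply: compact_closedI => //; exact: open_closedC.
- move: (oU); rewrite openE => oU' g [Ug nVg].
  suff nV : nbhs g (~` V) by exact: filterI (oU' _ Ug) nV.
  apply: contrapT => ng.
  have clg : closure V g.
    move=> B Bg; apply: contrapT => VB; apply: ng; apply: filterS Bg => h Bh Vh.
    by apply: VB; exists h.
  have PF : ProperFilter (within V (nbhs g)) by exact: within_nbhs_proper.
  have [|h [Vh hc]] := cV _ PF; first exact: withinT.
  apply: nVg; suff -> : g = h by [].
  apply: unit_inj; [exact: Uu|exact: Vu|].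
  exact: src_lim PF hc (cvg_within _).
- by apply: units_bisection => g [/Uu].
Qed.

Definition slice s : set germ := [set g | exists2 p, pg_elt p = s & g = pgerm p].

Lemma slice_cyl s : slice s = cyl s [::].
Proof. by apply/seteqP; split=> [g [p ps gp]|g [p [ps gp _]]]; exists p. Qed.

Lemma ultra_has (T : Type) (I : eqType) (F : set_system T) (P : T -> I -> bool)
    (l : seq I) : UltraFilter F -> F [set x | has (P x) l] ->
  exists2 i, i \in l & F [set x | P x i].
Proof.
move=> FU; elim: l => [|i l IH] /=; first by move=> /filter_ex[].
have [Fi _|Fi Fl] := in_ultra_setVsetC [set x | P x i] FU.
  by exists i => //; rewrite mem_head.
have [|j jl Fj] := IH.
  by apply: filterS (filterI Fi Fl) => x [/= ni /orP[]].
by exists j => //; rewrite inE jl orbT.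
Qed.

Lemma compact_slice s : compact (slice s).
Proof.
rewrite compact_ultra => F FU Fs.
pose phi e : bool := `[< F [set h | src h e] >].
have phiE e : phi e <-> F [set h | src h e] by split=> /asboolP.
have phiI e f : phi (e `&` f)%O = phi e && phi f.
  apply/idP/andP => [/phiE h|[/phiE he /phiE hf]].
    by split; apply/phiE; apply: filterS h => x /=; rewrite xcharI => /andP[].
  apply/phiE; apply: filterS (filterI he hf) => x [/= xe xf].
  by rewrite xcharI xe xf.
have phid : phi (dom s).
  by apply/phiE; apply: filterS Fs => _ [p <- ->] /=; rewrite srcE pg_dom.
have phi_rep : representation phi.
  split; last exact: phiI.
  by apply/negP => /phiE/filter_ex[x /=]; rewrite xchar0.
have phi_char : character phi by split=> //; exists (dom s).
have phi_tj : to_join (invariant_closure X) phi.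
  split=> //.
    by move=> y; exists [:: dom s]; rewrite big_seq1 phid; case: y.
  move=> e A eA; rewrite joinbE.
  have srcA (x : germ) : src x e = has (src x) A.
    by have [_ _ /(_ _ _ eA) ->] := xchar_to_join (src x); rewrite joinbE.
  apply/idP/hasP => [/phiE h|[x xA /phiE h]].
    have [|i iA Fi] := @ultra_has _ _ F (fun x : germ => src x) A FU.
      by apply: filterS h => x /=; rewrite srcA.
    by exists i => //; apply/phiE.
  apply/phiE; apply: filterS h => y /= yx; rewrite srcA; apply/hasP.
  by exists x.
pose p := @PreGerm S X s (XChar phi_char phi_tj) phid.
exists (pgerm p); split; first by exists p.
move=> A /nbhs_germP[w [l [/pgermP[/= pw [e pe we]] wl sA]]].
have Fl : F [set h | forall f, f \in l -> ~~ src h f].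
  have {wl} : forall f, f \in l -> ~~ phi f by move=> f /wl; rewrite -pw.
  elim: l {sA} => [_|f l IH nl]; first by apply: filterS filterT.
  have [h|h1] := in_ultra_setVsetC [set h | src h f] FU.
    by have /negP[] := nl f (mem_head _ _); apply/phiE.
  have h2 := IH (fun f' hf' => nl f' (@mem_behead _ (f :: l) f' hf')).
  apply: filterS (filterI h1 h2) => h [/= hf hl] f'.
  by rewrite inE => /orP[/eqP ->|]; [exact/negP|exact: hl].
have Fe : F [set h | src h e] by apply/phiE.
apply: filterS (filterI Fs (filterI Fl Fe)) => _ [[q qs ->] [/= ql qe]].
move: qe; rewrite srcE => /pgerm_res[r [re rq rg]].
have : pg_elt r = pg_elt w * val e by rewrite re qs.
move=> /pgerm_ext[v [vw vr vg _]]; apply: sA; exists v; split=> //.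
  by rewrite vg rg.
by move=> f fl; rewrite vr rq -srcE ql.
Qed.

Lemma bisection_slice s : bisection (slice s).
Proof.
have h1 p q : pg_elt p = pg_elt q -> pg_chr p = pg_chr q -> pgerm p = pgerm q.
  by move=> ? ?; congr pgerm; exact: pregerm_eq.
split=> g h; rewrite !inE => -[p ps ->] [q qs ->].
  by rewrite !srcE; apply: h1; rewrite ps qs.
rewrite !tgtE => pq; apply: h1; first by rewrite ps qs.
rewrite -[LHS]act_pinv -[RHS]act_pinv; congr act.
by apply: pregerm_eq; rewrite //= ps qs.
Qed.

Lemma cob_slice s : compact_open_bisection (slice s).
Proof.
split; [exact: compact_slice| |exact: bisection_slice].
by rewrite slice_cyl; exact: open_cyl.
Qed.

End GermTheory.

Record booleanization (S : invSemigroupType)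
    (X : set (idem S * {fset idem S})) := CobSet {
  cob_set :> set (germ X);
  cobP : compact_open_bisection cob_set
}.

Arguments cob_set {S X} b.

Section Booleanization.
Variables (S : invSemigroupType) (X : set (idem S * {fset idem S})).
Local Notation BX := (booleanization X).
Implicit Types U V W : BX.

Lemma cob_set_inj U V : cob_set U = cob_set V -> U = V.
Proof.
by case: U V => [U pU] [V pV] /= UV; subst V; congr CobSet; exact: Prop_irrelevance.
Qed.

HB.instance Definition _ := gen_eqMixin BX.
HB.instance Definition _ := gen_choiceMixin BX.

Definition bx_mul U V : BX := CobSet (cob_bmul (cobP U) (cobP V)).
Definition bx_inv U : BX := CobSet (cob_binv (cobP U)).
Definition bx0 : BX := CobSet (cob0 X).

Lemma bx_mulA : associative bx_mul.
Proof. by move=> U V W; apply: cob_set_inj; exact: bmulA. Qed.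

HB.instance Definition _ := isSemigroup.Build BX bx_mulA.

Lemma bx_bis U : bisection U. Proof. by case: U => [? []]. Qed.

Lemma bx_mulsVs U : U * bx_inv U * U = U.
Proof. by apply: cob_set_inj; exact: (bmulVK (bx_bis U)). Qed.

Lemma bx_invK U : bx_inv (bx_inv U) = U.
Proof. by apply: cob_set_inj; exact: binvK. Qed.

Lemma bx_mulVsV U : bx_inv U * U * bx_inv U = bx_inv U.
Proof. by rewrite -{2}(bx_invK U) bx_mulsVs. Qed.

Lemma bx_idem U : U * U = U -> U `<=` @is_unit S X.
Proof. by move=> /(congr1 cob_set); apply: bisection_idem; exact: bx_bis. Qed.

Lemma bx_idemI U V : U * U = U -> V * V = V ->
  cob_set (U * V) = cob_set U `&` cob_set V.
Proof. by move=> /bx_idem uU /bx_idem uV; exact: bmul_units. Qed.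

Lemma bx_sinv_uniq U V : U * V * U = U -> V * U * V = V -> V = bx_inv U.
Proof.
apply: regular_inv_uniq; [exact: bx_mulsVs|exact: bx_mulVsV|].
by move=> e f ee ff; apply: cob_set_inj; rewrite !bx_idemI // setIC.
Qed.

Lemma bx_mul0s U : bx0 * U = bx0.
Proof.
by apply: cob_set_inj; apply/seteqP; split=> // k [g [h [c [[]]]]].
Qed.

Lemma bx_muls0 U : U * bx0 = bx0.
Proof.
by apply: cob_set_inj; apply/seteqP; split=> // k [g [h [c [_ []]]]].
Qed.

HB.instance Definition _ := Semigroup_isInverse.Build BX
  bx_mulsVs bx_mulVsV bx_sinv_uniq bx_mul0s bx_muls0.

Implicit Types e f : idem BX.

Lemma ebx_unit e : val e `<=` @is_unit S X.
Proof. exact/bx_idem/idem_valK. Qed.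

Lemma ebx_meet e f : val (e `&` f)%O = val e `&` val f :> set _.
Proof. by apply: bx_idemI; exact: idem_valK. Qed.

Lemma ebx_inj e f : cob_set (val e) = cob_set (val f) -> e = f.
Proof. by move=> ef; apply/val_inj/cob_set_inj. Qed.

Lemma ebx_le e f : reflect (val e `<=` val f)%classic (e <= f).
Proof.
apply: (iffP meet_idPl) => [<-|ef].
  by rewrite ebx_meet; exact: subIsetr.
by apply: ebx_inj; rewrite ebx_meet; exact/setIidl.
Qed.

Lemma unit_idem U : U `<=` @is_unit S X -> U * U = U.
Proof.
by move=> Uu; apply: cob_set_inj; rewrite [LHS]bmul_units // setIid.
Qed.

Lemma ebx_join_subproof e f : compact_open_bisection (val e `|` val f).
Proof.
apply: cob_setU; [exact: cobP|exact: cobP|].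
by apply: units_bisection => g [/ebx_unit|/ebx_unit].
Qed.

Lemma ebx_joinP e f : CobSet (ebx_join_subproof e f) *
  CobSet (ebx_join_subproof e f) = CobSet (ebx_join_subproof e f).
Proof. by apply: unit_idem => g [/ebx_unit|/ebx_unit]. Qed.

Definition ebx_join e f : idem BX := mk_idem (ebx_joinP e f).

Lemma ebx_diff_subproof e f : compact_open_bisection (val e `\` val f).
Proof.
by apply: cob_setD; [exact: ebx_unit|exact: ebx_unit|exact: cobP|exact: cobP].
Qed.

Lemma ebx_diffP e f : CobSet (ebx_diff_subproof e f) *
  CobSet (ebx_diff_subproof e f) = CobSet (ebx_diff_subproof e f).
Proof. by apply: unit_idem => g [/ebx_unit]. Qed.

Definition ebx_diff e f : idem BX := mk_idem (ebx_diffP e f).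

Lemma ebx_join_le e f h : (ebx_join e f <= h) = (e <= h) && (f <= h).
Proof.
apply/ebx_le/andP => [efh|[/ebx_le eh /ebx_le fh]].
  by split; apply/ebx_le => g gh; apply: efh; [left|right].
by move=> g [/eh|/fh].
Qed.

Lemma ebx_meetUl : left_distributive (@Order.meet _ (idem BX)) ebx_join.
Proof.
move=> e f h; apply: ebx_inj; rewrite ebx_meet.
rewrite -[RHS]/(cob_set (val (e `&` h)%O) `|` cob_set (val (f `&` h)%O)).
by rewrite !ebx_meet; exact: setIUl.
Qed.

Lemma ebx_diffKI e f : (f `&` ebx_diff e f)%O = \bot%O.
Proof.
apply: ebx_inj; rewrite ebx_meet; apply/seteqP; split=> // g.
by move=> [fg [_ /(_ fg)]].
Qed.

Lemma ebx_joinIB e f : ebx_join (e `&` f)%O (ebx_diff e f) = e.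
Proof.
apply: ebx_inj.
rewrite -[LHS]/(cob_set (val (e `&` f)%O) `|` (val e `\` val f)) ebx_meet.
apply/seteqP; split=> g.
  by move=> [[]|[]].
by move=> eg; have [fg|nfg] := pselect (cob_set (val f) g); [left|right].
Qed.

Lemma bx_nle U V : nle U V <-> U `<=` V.
Proof.
split=> [[e ->] k [g [h [c [Vg eh ->]]]]|UV].
  by rewrite unit_mulr //; exact: ebx_unit eh.
exists (dom U); apply: cob_set_inj.
rewrite -[val (dom U)]/(bx_inv U * U) mulgA.
by apply/esym/(bmulVK (bx_bis V)).
Qed.

Lemma bx_compatible_bis U V : compatible U V -> bisection (U `|` V).
Proof.
move=> [UV1 UV2].
have src_inj g h : cob_set U g -> cob_set V h -> src g = src h -> g = h.
  by apply: unit_div_inj; exact: bx_idem UV2.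
have tgt_inj g h : cob_set U g -> cob_set V h -> tgt g = tgt h -> g = h.
  move=> Ug Vh gh; apply: (can_inj (@ginvK S X)).
  apply: (@unit_div_inj S X (binv U) (binv V)); rewrite ?src_ginv ?binvE ?ginvK //.
  by rewrite binvK; exact: bx_idem UV1.
have [Us Ut] := bx_bis U; have [Vs Vt] := bx_bis V.
split=> g h; rewrite !inE => -[g1|g1] [h1|h1] gh.
- by apply: Us; rewrite ?inE.
- exact: src_inj.
- by apply/esym/src_inj.
- by apply: Vs; rewrite ?inE.
- by apply: Ut; rewrite ?inE.
- exact: tgt_inj.
- by apply/esym/tgt_inj.
- by apply: Vt; rewrite ?inE.
Qed.

Lemma bx_compatible_join U V : compatible U V ->
  exists W, is_join [set U; V] W.
Proof.
move=> /bx_compatible_bis bUV; exists (CobSet (cob_setU (cobP U) (cobP V) bUV)).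
split=> [W [->|->]|W UW].
- by apply/bx_nle => g; left.
- by apply/bx_nle => g; right.
have /bx_nle sU : nle U W by apply: UW; left.
have /bx_nle sV : nle V W by apply: UW; right.
by apply/bx_nle => g [/sU|/sV].
Qed.

HB.instance Definition _ := InvSemigroup_isBoolean.Build BX
  ebx_join_le ebx_meetUl ebx_diffKI ebx_joinIB bx_compatible_join.

Definition biota (s : S) : BX := CobSet (cob_slice X s).

End Booleanization.

Arguments biota {S} X s.

(* Main.v *)
Require Import Defs.
From HB Require Import structures.
From mathcomp Require Import all_boot all_order finmap.
From mathcomp Require Import all_classical topology.

Set Implicit Arguments.
Unset Strict Implicit.
Unset Printing Implicit Defensive.

Import Order.Theory.

Local Open Scope classical_set_scope.
Local Open Scope order_scope.
Local Open Scope invsemi_scope.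

(** Every element of the Booleanization is built from the slices [biota X s] by
products, differences of idempotents and compatible joins
([booleanization_ind]): a compact-open bisection is a finite union of basic open
sets, and each of these is a slice restricted to a difference of idempotents.
A morphism respects these constructions, which gives uniqueness.

For existence, [B] is described by its points, the Boolean algebra morphisms
[pi : idem B -> bool], that is, the units of the groupoid of ultrafilters of [B].
If [phi] is an [X]-to-join representation, then [pi \o phi] is an
[X']-to-join character, so that [phi] acts contravariantly on units. The element
[psi U] should be the one whose germ at [pi] lies above the germ of [U] at
[pi \o phi], for all [pi], and should have no germ at [pi] when [U] has no germ
at [pi \o phi]. This requirement is the relation [lifts U b].
- By the prime ideal theorem an element of [B] is determined by its germs at
  points ([nle_points]), hence [lifts] is functional ([lifts_inj]).
- Being a condition on germs, [lifts] is compatible with products, inverses,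
  differences of idempotents and compatible joins ([lifts_mul], [lifts_inv],
  [lifts_diff], [lifts_join]), and it relates [biota X s] to [phi s]. By the
  induction principle above each [U] is lifted by some [b] ([lifts_ex]).
The resulting function [psi] is a morphism because [lifts] is functional and
compatible with the operations, and no choices of decompositions of [U] have to
be compared. Properness of [psi] is inherited from [phi = psi \o biota X]. *)

(** * Points of a generalized Boolean algebra *)

Section Points.
Context {d : Order.disp_t} {A : cbDistrLatticeType d}.
Implicit Types (x y z : A) (I M : set A) (pi : A -> bool).

Record ideal I : Prop := {
  ideal_bot : I \bot;
  ideal_le : forall x y, x <= y -> I y -> I x;
  ideal_join : forall x y, I x -> I y -> I (x `|` y)
}.

(** Into [bool], properness means being non-zero, and the difference is
determined by the other operations. *)
Lemma boolalg_morphism_bool pi :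
  pi \bot = false -> {morph pi : x y / x `|` y >-> x || y} ->
  {morph pi : x y / x `&` y >-> x && y} -> (exists x, pi x) ->
  boolalg_morphism pi.
Proof.
move=> p0 pU pI [a pa]; split=> //.
- move=> x y; have := pU (x `&` y) (x `\` y); rewrite joinIB.
  have := pI y (x `\` y); rewrite diffKI p0 pI.
  rewrite subEbool /=.
  by case: (pi x) (pi y) (pi (x `\` y)) => [] [] [].
- by move=> y; exists [:: a]; rewrite big_seq1 pa; case: y.
Qed.

Section PointTheory.
Variables (pi : A -> bool) (piP : boolalg_morphism pi).

Lemma point0 : pi \bot = false. Proof. exact: bam_bot piP. Qed.

Lemma pointU x y : pi (x `|` y) = pi x || pi y. Proof. exact: bam_join piP x y. Qed.

Lemma pointI x y : pi (x `&` y) = pi x && pi y. Proof. exact: bam_meet piP x y. Qed.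

Lemma pointD x y : pi (x `\` y) = pi x && ~~ pi y.
Proof. by rewrite (bam_diff piP) subEbool. Qed.

Lemma point_le x y : x <= y -> pi x -> pi y.
Proof. by move=> /meet_idPl <-; rewrite pointI => /andP[]. Qed.

Lemma point_joins (T : eqType) (s : seq T) (F : T -> A) :
  pi (\join_(i <- s) F i) = has (pi \o F) s.
Proof.
by elim: s => [|i s IH]; rewrite ?big_nil ?big_cons ?point0 // pointU IH.
Qed.

End PointTheory.

(** The prime ideal theorem: the complement of an ideal that is maximal among
those avoiding [a] is a prime filter. *)
Lemma point_separation I a : ideal I -> ~ I a ->
  exists pi : A -> bool, [/\ boolalg_morphism pi, pi a & forall x, I x -> ~~ pi x].
Proof.
move=> idI nIa.
(* Zorn's lemma is applied to the sets to be added to [I], so that the empty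
   chain has an upper bound. *)
pose P M := ideal (I `|` M) /\ ~ (I `|` M)%classic a.
have [F FP tot|M [[idM nMa] Mmax]] := @Zorn_bigcup A P.
  have chain x y : (I `|` \bigcup_(M in F) M)%classic x ->
      (I `|` \bigcup_(M in F) M)%classic y ->
      (I x /\ I y) \/ exists M, [/\ F M, (I `|` M)%classic x & (I `|` M)%classic y].
    move=> [Ix|[M FM Mx]] [Iy|[N FN Ny]]; [by left|right..].
    - by exists N; split=> //; [left|right].
    - by exists M; split=> //; [right|left].
    have [MN|NM] := tot _ _ FM FN.
      by exists N; split=> //; right=> //; exact: MN.
    by exists M; split=> //; right=> //; exact: NM.
  have sub M : F M -> (I `|` M `<=` I `|` \bigcup_(M in F) M)%classic.
    by move=> FM x [Ix|Mx]; [left|right; exists M].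
  split; first split.
  - by left; exact: ideal_bot.
  - move=> x y xy [Iy|[M FM My]]; first by left; exact: ideal_le xy Iy.
    by apply: (sub _ FM); apply: (ideal_le (FP _ FM).1 xy); right.
  - move=> x y Ux Uy; have [[Ix Iy]|[M [FM Mx My]]] := chain _ _ Ux Uy.
      by left; exact: ideal_join.
    by apply: (sub _ FM); exact: ideal_join (FP _ FM).1 _ _ Mx My.
  - by move=> [//|[M FM Ma]]; apply: (FP _ FM).2; right.
set K := (I `|` M)%classic in idM nMa.
(* Enlarging the maximal [K] by [x] captures [a]. *)
have Kmax x : ~ K x -> exists2 m, K m & a <= m `|` x.
  move=> nKx; pose N := [set y | exists2 m, K m & y <= m `|` x].
  have KN : K `<=` N by move=> m Km; exists m => //; exact: leUl.
  have Nx : N x by exists \bot; [exact: ideal_bot|exact: leUr].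
  have IN : (I `|` N)%classic = N by apply/setUidPr => y Iy; apply: KN; left.
  apply: contrapT => nNa; apply: (Mmax N).
    rewrite properEneq; split; last by move=> y My; apply: KN; right.
    by apply/eqP => MN; apply: nKx; right; rewrite MN.
  suff idN : ideal N by split; rewrite IN // => -[m Km am]; apply: nNa; exists m.
  split; first by apply: KN; exact: ideal_bot.
  - by move=> y z yz [m Km zm]; exists m => //; exact: le_trans zm.
  - move=> y z [m Km ym] [n Kn zn]; exists (m `|` n); first exact: ideal_join.
    rewrite leUx; apply/andP; split.
      by apply: le_trans ym _; rewrite leU2 ?leUl.
    by apply: le_trans zn _; rewrite leU2 ?leUr.
have Kprime x y : K (x `&` y) -> K x \/ K y.
  move=> Kxy; apply: contrapT => /not_orP[/Kmax[m Km am] /Kmax[n Kn an]].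
  apply: nMa; apply: (ideal_le idM (y := (m `|` n) `|` (x `&` y))).
    rewrite joinIr lexI; apply/andP; split.
      by apply: le_trans am _; rewrite leU2 ?leUl.
    by apply: le_trans an _; rewrite leU2 ?leUr.
  by apply: ideal_join => //; exact: ideal_join.
exists (fun x => ~~ `[< K x >]); split; last 2 first.
- exact/asboolPn.
- by move=> x Ix; rewrite negbK; apply/asboolP; left.
apply: boolalg_morphism_bool; last by exists a; exact/asboolPn.
- by apply/negbF/asboolP; exact: ideal_bot.
- move=> x y; rewrite -negb_and; congr (~~ _).
  apply/asboolP/andP => [Kxy|[/asboolP Kx /asboolP Ky]]; last exact: ideal_join.
  by split; apply/asboolP; apply: ideal_le Kxy => //; [exact: leUl|exact: leUr].
- move=> x y; rewrite -negb_or; congr (~~ _).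
  apply/asboolP/orP => [/Kprime[Kx|Ky]|[/asboolP Kx|/asboolP Ky]].
  + by left; apply/asboolP.
  + by right; apply/asboolP.
  + by apply: ideal_le Kx => //; exact: leIl.
  + by apply: ideal_le Ky => //; exact: leIr.
Qed.

End Points.

(** * Inverse semigroups *)

Section InverseSemigroups.
Variable S : invSemigroupType.
Implicit Types (a b c s t : S) (e f : idem S).

Lemma dom_val e : dom (val e) = e.
Proof. by apply/val_inj; rewrite /= (idem_inv (idem_valK e)) idem_valK. Qed.

Lemma val_meet e f : val (e `&` f) = val e * val f.
Proof. by []. Qed.

Lemma mul_dom a : a * val (dom a) = a.
Proof. by rewrite /= mulgA mulsVs. Qed.

Lemma dom_mulE a b : dom (a * b) = econj b (dom a).
Proof. by apply/val_inj; rewrite /= sinvM !mulgA. Qed.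

Lemma econj_le s e f : e <= f -> econj s e <= econj s f.
Proof. by move=> /meet_idPl <-; rewrite econjI leIr. Qed.

Lemma econj_dom s e : econj s e <= dom s.
Proof. by apply/meet_idPl/val_inj; rewrite /= -!mulgA (mulgA s) mulsVs. Qed.

Lemma econj_mul s e f : econj (s * val e) f = e `&` econj s f `&` e.
Proof. by apply/val_inj; rewrite /= sinvM (idem_inv (idem_valK e)) !mulgA. Qed.

Lemma econjM s t e : econj (s * t) e = econj t (econj s e).
Proof. by apply/val_inj; rewrite /= sinvM !mulgA. Qed.

Lemma econjVK s e : econj s (econj s^-1 e) = dom s `&` e.
Proof.
rewrite -econjM -[s^-1 * s]/(val (dom s)); apply/val_inj.
rewrite /= sinvM sinvK -/(val (dom s)) -[s^-1 * s]/(val (dom s)) valC.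
by rewrite -mulgA idem_valK valC.
Qed.

Lemma nle_dom_mul a b : nle a b -> a = b * val (dom a).
Proof.
by move=> [e ->]; rewrite dom_mul val_meet mulgA mul_dom.
Qed.

Lemma nle_dom a b : nle a b -> dom a <= dom b.
Proof. by move=> [e ->]; rewrite dom_mul leIl. Qed.

Lemma nle_mulr a e : nle (a * val e) a. Proof. by exists e. Qed.

Lemma nle_mul2l a e f : e <= f -> nle (a * val e) (a * val f).
Proof.
move=> /meet_idPr <-; exists e; rewrite -mulgA; congr (_ * _).
Qed.

Lemma nle_val e f : e <= f -> nle (val e) (val f).
Proof. by move=> /meet_idPr ef; exists e; rewrite -{1}ef. Qed.

Lemma nle_dom_eq a b : nle a b -> dom b <= dom a -> a = b.
Proof.
move=> ab ba; rewrite (nle_dom_mul ab) -[RHS]mul_dom.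
by congr (_ * val _); apply/le_anti; rewrite ba nle_dom.
Qed.

Lemma nle_compatible a b c : nle a c -> nle b c -> compatible a b.
Proof.
move=> [e ->] [f ->]; split.
  rewrite sinvM (idem_inv (idem_valK e)).
  have -> : val e * c^-1 * (c * val f) = val (e `&` dom c `&` f).
    by rewrite /= !mulgA.
  exact: idem_valK.
rewrite sinvM (idem_inv (idem_valK f)).
have -> : c * val e * (val f * c^-1) = val (econj c^-1 (e `&` f)).
  by rewrite /= sinvK !mulgA.
exact: idem_valK.
Qed.

(** On [econj b^-1 e = rng (b * val e)] both inverses restrict to the inverse of
[b * val e]. *)
Lemma agree_inv b c e :
  b * val e = c * val e ->
  econj b^-1 e = econj c^-1 e /\
  b^-1 * val (econj b^-1 e) = c^-1 * val (econj b^-1 e).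
Proof.
move=> bc; have invE a : val e * a^-1 = (a * val e)^-1.
  by rewrite sinvM (idem_inv (idem_valK e)).
have rE : econj b^-1 e = econj c^-1 e.
  apply/val_inj; rewrite /= !sinvK -[val e]idem_valK !mulgA bc -!mulgA.
  by rewrite !invE bc.
by split=> //; rewrite {2}rE !mul_econj !invE bc.
Qed.

Lemma is_join_uniq a b c c' : is_join [set a; b] c -> is_join [set a; b] c' -> c = c'.
Proof.
move=> [ub lub] [ub' lub']; apply: nle_dom_eq; first exact: lub.
by apply: nle_dom; exact: lub'.
Qed.

End InverseSemigroups.

Lemma morph_sinv (S T : invSemigroupType) (phi : S -> T) :
  semigroup_morphism phi -> forall a, phi a^-1 = (phi a)^-1.
Proof.
by move=> phiM a; apply: sinv_uniq; rewrite -!phiM ?mulsVs ?mulVsV.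
Qed.

Section RestrictionTheory.
Variables (S T : invSemigroupType) (phi : S -> T) (phiM : semigroup_morphism phi).

Lemma erestr_dom a : erestr phiM (dom a) = dom (phi a).
Proof. by apply/val_inj; rewrite /= phiM morph_sinv. Qed.

Lemma erestr_econj s e : erestr phiM (econj s e) = econj (phi s) (erestr phiM e).
Proof. by apply/val_inj; rewrite /= !phiM morph_sinv. Qed.

End RestrictionTheory.

(** * Boolean inverse semigroups *)

Section BooleanInverseSemigroups.
Variable B : boolInvSemigroupType.
Implicit Types (a b c : B) (e f : idem B).

Lemma dom_join a b c : is_join [set a; b] c -> dom c = dom a `|` dom b.
Proof.
move=> [ub lub]; have ac : nle a c by apply: ub; left.
have bc : nle b c by apply: ub; right.
apply/le_anti; rewrite leUx !nle_dom // !andbT.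
set u := _ `|` _; suff /nle_dom : nle c (c * val u).
  by rewrite dom_mul lexI => /andP[].
apply: lub => _ [->|->].
  by rewrite {1}(nle_dom_mul ac); apply: nle_mul2l; exact: leUl.
by rewrite {1}(nle_dom_mul bc); apply: nle_mul2l; exact: leUr.
Qed.

(** Both products are the join of their restrictions to [e] and to [f]. *)
Lemma mul_agreeU a b e f : a * val e = b * val e -> a * val f = b * val f ->
  a * val (e `|` f) = b * val (e `|` f).
Proof.
have joinE c j : is_join [set c * val e; c * val f] j -> j = c * val (e `|` f).
  move=> jP; apply: nle_dom_eq; last by rewrite (dom_join jP) !dom_mul meetUr.
  by apply: jP.2 => _ [->|->]; apply: nle_mul2l; [exact: leUl|exact: leUr].
move=> ae af.
have [j jP] := compatible_join _ _ (nle_compatible (nle_mulr a e) (nle_mulr a f)).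
by rewrite -(joinE _ _ jP); rewrite ae af in jP; exact: joinE.
Qed.

(** Conjugation is an order isomorphism from [[\bot, rng b]] to [[\bot, dom b]]. *)
Lemma econjU b : {morph econj b : e f / e `|` f}.
Proof.
move=> e f; apply/le_anti; rewrite leUx !econj_le ?leUl ?leUr // !andbT.
set y := econj b e `|` _.
have rK g : g `&` rng b = econj b^-1 (econj b g).
  have := econjVK b^-1 g; rewrite sinvK => ->; rewrite meetC; congr (_ `&` _).
  by apply/val_inj; rewrite /= sinvK.
have -> : econj b (e `|` f) = econj b ((e `|` f) `&` rng b).
  rewrite econjI econj_rng; apply/esym/meet_idPl; exact: econj_dom.
have : (e `|` f) `&` rng b <= econj b^-1 y.
  by rewrite meetUl leUx !rK; apply/andP; split; apply: econj_le; rewrite ?leUl ?leUr.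
by move=> /(econj_le b) h; apply: le_trans h _; rewrite econjVK leIr.
Qed.

Lemma point_econj (pi : idem B -> bool) b : boolalg_morphism pi ->
  pi (dom b) -> boolalg_morphism (pi \o econj b).
Proof.
move=> piP pb; apply: boolalg_morphism_bool => [|e f|e f|] /=.
- by rewrite econj0 point0.
- by rewrite econjU pointU.
- by rewrite econjI pointI.
- by exists (rng b); rewrite econj_rng.
Qed.

(** The idempotents on which [b] and [c] agree form an ideal; were [dom b] not
among them, a point would separate them. *)
Lemma nle_points b c :
  (forall pi : idem B -> bool, boolalg_morphism pi -> pi (dom b) ->
     exists2 e, pi e & b * val e = c * val e) -> nle b c.
Proof.
move=> H; exists (dom b); rewrite -{1}[b]mul_dom; apply: contrapT => nbc.
have idI : ideal [set e : idem B | b * val e = c * val e].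
  split=> [|e f /meet_idPr <-|e f]; last exact: mul_agreeU.
    by rewrite /= !muls0.
  by move=> fE; rewrite /= !mulgA fE.
have [pi [piP /(H _ piP)[e pe eE] nI]] := point_separation idI nbc.
by have := nI e eE; rewrite pe.
Qed.

Lemma ejoin_is_join e f : is_join [set val e; val f] (val (e `|` f)).
Proof.
have eU : nle (val e) (val (e `|` f)) by apply: nle_val; exact: leUl.
have fU : nle (val f) (val (e `|` f)) by apply: nle_val; exact: leUr.
have [j jP] := compatible_join _ _ (nle_compatible eU fU).
suff <- : j = val (e `|` f) by [].
apply: nle_dom_eq; last by rewrite (dom_join jP) !dom_val.
by apply: jP.2 => _ [->|->].
Qed.

End BooleanInverseSemigroups.


(** * Generation of the Booleanization *)

Section Generation.
Variables (S : invSemigroupType) (X : set (idem S * {fset idem S})).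
Local Notation BX := (booleanization X).
Local Notation germ := (germ X).
Local Notation slice := (@slice S X).
Local Notation cyl := (@cyl S X).
Implicit Types (s t : S) (e f : idem S) (g h k : germ) (U V W : BX).

Lemma slice_valE e g : slice (val e) g <-> is_unit g /\ src g e.
Proof.
split=> [[p pe ->]|[gu ge]].
  split; first by exists p => //; rewrite pe idem_valK.
  by rewrite srcE -(dom_val e) -pe; exact: pg_dom.
have he : src g (dom (val e)) by rewrite dom_val.
exists (PreGerm he) => //; apply: unit_inj; rewrite ?srcE //.
by exists (PreGerm he) => //=; exact: idem_valK.
Qed.

Lemma unit_at (x : xchar X) : exists2 h, is_unit h & src h = x.
Proof.
have [_ [e xe]] := xchar_character x.
have he : x (dom (val e)) by rewrite dom_val.
exists (pgerm (PreGerm he)); last by rewrite srcE.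
by exists (PreGerm he) => //=; exact: idem_valK.
Qed.

Lemma bmul_unitsr (A C : set germ) k : C `<=` @is_unit S X ->
  bmul A C k <-> A k /\ exists2 h, C h & src h = src k.
Proof.
move=> Cu; split=> [[g [h [c [Ag Ch ->]]]]|[Ak [h Ch hk]]].
  rewrite unit_mulr; last exact: Cu.
  by split=> //; exists h => //; rewrite c unit_tgt //; exact: Cu.
have c : src k = tgt h by rewrite unit_tgt //; exact: Cu.
by exists k, h, c; split=> //; rewrite unit_mulr //; exact: Cu.
Qed.

Definition ebiota e : idem BX :=
  mk_idem (unit_idem (U := biota X (val e)) (fun g ge => ((slice_valE e g).1 ge).1)).

(** Adding [e] to the conditions of a cylinder removes the germs at characters
that do not vanish at [e]; this amounts to a right multiplication by units. *)
Lemma cyl_cons s e (l : seq (idem S)) : cyl s (e :: l) =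
  bmul (cyl s l) (val (ebiota (dom s) `\` ebiota e)).
Proof.
have inD h : cob_set (val (ebiota (dom s) `\` ebiota e)) h <->
    [/\ is_unit h, src h (dom s) & ~~ src h e].
  split=> [[/slice_valE[hu hs] nhe]|[hu hs he]].
    by split=> //; apply/negP => he; apply: nhe; exact/slice_valE.
  split; first exact/slice_valE.
  by move=> /slice_valE[_]; exact/negP.
apply/seteqP; split=> k.
  move=> [p [ps -> pl]]; apply/bmul_unitsr; first exact: ebx_unit.
  split; first by exists p; split=> // f fl; apply: pl; rewrite inE fl orbT.
  have [h hu hp] := unit_at (pg_chr p); exists h; last by rewrite srcE.
  apply/inD; rewrite hp; split=> //; last by apply: pl; rewrite mem_head.
  by rewrite -ps; exact: pg_dom.
move=> /bmul_unitsr[|[p [ps -> pl]] [h /inD[hu hs he] hk]]; first exact: ebx_unit.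
exists p; split=> // f; rewrite inE => /orP[/eqP ->|]; last exact: pl.
by move: he; rewrite hk srcE.
Qed.

Lemma bx_is_join U V W : cob_set W = cob_set U `|` cob_set V ->
  is_join [set U; V] W.
Proof.
move=> WE; split=> [_ [->|->]|Z ub]; apply/bx_nle; rewrite WE.
- exact: subsetUl.
- exact: subsetUr.
have /bx_nle UZ : nle U Z by apply: ub; left.
have /bx_nle VZ : nle V Z by apply: ub; right.
by rewrite subUset.
Qed.

Lemma cob_set_join U V W : compatible U V -> is_join [set U; V] W ->
  cob_set W = cob_set U `|` cob_set V.
Proof.
move=> /bx_compatible_bis bUV WP.
pose UV : BX := CobSet (cob_setU (cobP U) (cobP V) bUV).
have {}WP := is_join_uniq WP (bx_is_join (W := UV) erefl).
by rewrite WP.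
Qed.

(** By compactness every element is a finite union of cylinders, which are
pairwise compatible since they lie in one bisection; a cylinder is a product of
a slice with differences of idempotent slices. *)
Lemma booleanization_ind (P : BX -> Prop) :
  (forall s, P (biota X s)) ->
  (forall U V, P U -> P V -> P (U * V)) ->
  (forall E F : idem BX, P (val E) -> P (val F) -> P (val (E `\` F))) ->
  (forall U V W, compatible U V -> is_join [set U; V] W -> P U -> P V -> P W) ->
  forall U, P U.
Proof.
move=> Piota Pmul Pdiff Pjoin U.
pose Q (A : set germ) := exists2 W : BX, cob_set W = A & P W.
have Qcyl s l : Q (cyl s l).
  elim: l => [|e l [W WE PW]]; first by exists (biota X s) => //=; rewrite slice_cyl.
  exists (W * val (ebiota (dom s) `\` ebiota e)).
    by rewrite cyl_cons -WE.
  by apply: Pmul => //; apply: Pdiff; exact: Piota.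
have Q0 : Q set0.
  exists (biota X szero) => //; apply/seteqP; split=> // g [p p0 _].
  have := pg_dom p; rewrite p0.
  have -> : dom (szero : S) = \bot by apply/val_inj; rewrite /= muls0.
  by rewrite xchar0.
have QU A C : A `<=` cob_set U -> C `<=` cob_set U -> Q A -> Q C -> Q (A `|` C).
  move=> AU CU [V VE PV] [W WE PW]; subst A C.
  have bVW : bisection (cob_set V `|` cob_set W).
    have [Us Ut] := bx_bis U; have sU : cob_set V `|` cob_set W `<=` cob_set U.
      by rewrite subUset.
    split=> g h; rewrite !inE => /sU gU /sU hU; [apply: Us|apply: Ut];
      by rewrite inE.
  exists (CobSet (cob_setU (cobP V) (cobP W) bVW)) => //.
  apply: (Pjoin V W) => //; last exact: bx_is_join.
  by apply: (nle_compatible (c := U)); exact/bx_nle.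
have [cU oU _] := cobP U; suff [W WE PW] : Q (cob_set U).
  by suff -> : U = W by []; exact/cob_set_inj.
apply: contrapT => nQU.
(* Otherwise the complements in [U] of the subsets with [Q] generate a proper
   filter; it has no cluster point, for each point of [U] lies in a cylinder
   contained in [U]. *)
pose F := [set A | exists C, [/\ Q C, C `<=` cob_set U & cob_set U `\` C `<=` A]].
have FF : ProperFilter F.
  split=> [[C [QC CU UC]]|]; last split.
  - apply: nQU; suff -> : cob_set U = C by [].
    by apply/seteqP; split=> // g Ug; apply: contrapT => nCg; exact: UC (conj Ug nCg).
  - by exists set0; split=> // g [].
  - move=> A A' [C [QC CU UC]] [C' [QC' CU' UC']]; exists (C `|` C'); split.
    + exact: QU.
    + by rewrite subUset.
    + move=> g [Ug nCg]; split; last first.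
        by apply: UC'; split=> // Cg; apply: nCg; right.
      by apply: UC; split=> // Cg; apply: nCg; left.
  - by move=> A A' AA' [C [QC CU UC]]; exists C; split=> // g /UC/AA'.
have [|g [Ug clg]] := cU _ FF; first by exists set0; split=> // g [].
move: oU; rewrite openE => /(_ _ Ug) /nbhs_germP[p [l [gp pl sU]]].
have nC : nbhs g (cyl (pg_elt p) l).
  by apply: open_nbhs_nbhs; split; [exact: open_cyl|exists p].
have FC : F (~` cyl (pg_elt p) l).
  by exists (cyl (pg_elt p) l); split=> // h [].
by have [h []] := clg _ _ FC nC.
Qed.

Lemma bis_morphism_ext (B : boolInvSemigroupType) (psi psi' : BX -> B) :
  bis_morphism psi -> bis_morphism psi' ->
  psi \o biota X = psi' \o biota X -> psi = psi'.
Proof.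
move=> psiP psi'P iotaE; apply/funext; apply: booleanization_ind.
- by move=> s; have := congr1 (@^~ s) iotaE.
- by move=> U V UE VE; rewrite (bm_mul psiP) (bm_mul psi'P) UE VE.
- move=> E F EE FE.
  have := congr1 val (bam_diff (bm_restr psiP) E F).
  have := congr1 val (bam_diff (bm_restr psi'P) E F).
  have -> : erestr (bm_mul psiP) E = erestr (bm_mul psi'P) E by apply/val_inj.
  have -> : erestr (bm_mul psiP) F = erestr (bm_mul psi'P) F by apply/val_inj.
  by move=> /= -> ->.
- move=> U V W UV WP UE VE; apply: (is_join_uniq (bm_join psiP UV WP)).
  by rewrite UE VE; exact: bm_join.
Qed.

End Generation.

(** * Lifting germs along a representation *)

Section Lifting.
Variables (S : invSemigroupType) (X : set (idem S * {fset idem S})).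
Variables (B : boolInvSemigroupType) (phi : S -> B).
Variables (phiM : semigroup_morphism phi) (phiX : to_join X (erestr phiM)).
Local Notation BX := (booleanization X).
Local Notation germ := (germ X).
Local Notation phiE := (erestr phiM).
Implicit Types (s : S) (b c : B) (g : germ) (p : pregerm X) (pi : idem B -> bool).

(** The pairs whose join [phi] preserves form an [S]-invariant set, because
conjugation in [B] preserves joins. *)
Lemma to_join_closure : to_join (invariant_closure X) phiE.
Proof.
case: phiX => rep prop XJ; split=> // e D eD.
pose Y := [set x : idem S * {fset idem S} | phiE x.1 = \join_(y <- x.2) phiE y].
suff : Y (e, D) by [].
apply: eD; split=> {e D} [e D eD s|[e D]]; last exact: XJ.
rewrite /Y /= erestr_econj {}eD.
have -> : econj (phi s) (\join_(y <- D) phiE y) =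
    \join_(y <- D) phiE (econj s y).
  rewrite (big_morph _ (econjU (phi s)) (econj0 (phi s))).
  by apply: eq_bigr => y _; rewrite erestr_econj.
apply/le_anti/andP; split; apply/joinsP_seq => y yD _.
  apply: (@joins_sup_seq _ _ _ _ _ phiE (econj s y)) => //.
  by apply/imfsetP; exists y.
have /imfsetP[z /= zD ->] := yD.
exact: (@joins_sup_seq _ _ _ _ _ (phiE \o econj s) z).
Qed.

Lemma xchar_point pi : boolalg_morphism pi ->
  exists x : xchar X, x =1 pi \o phiE.
Proof.
move=> piP; have [[r0 rI] prop XJ] := to_join_closure.
have rep : representation (pi \o phiE).
  by split=> [|e f] /=; rewrite ?r0 ?rI ?point0 ?pointI.
have [a pa] : exists a, (pi \o phiE) a.
  have [y py] : exists y, pi y.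
    have [s] := bam_proper piP true; rewrite joinbE.
    by case: hasP => // -[y _ py] _; exists y.
  have [s ys] := prop y; have := point_le piP ys py.
  by rewrite point_joins // => /hasP[a _ pa]; exists a.
have tj : to_join (invariant_closure X) (pi \o phiE).
  split=> // [y|e D eD]; first by exists [:: a]; rewrite big_seq1 pa; case: y.
  by rewrite /= (XJ _ _ eD) point_joins // joinbE.
by exists (XChar (conj rep (ex_intro _ a pa)) tj).
Qed.

(** The germ of [b] at [pi] lies above [g]: it is the germ of [phi s] for some
germ [[s, pi \o phi]] equal to [g]. *)
Definition over pi b g := src g =1 pi \o phiE /\
  exists2 p, g = pgerm p &
    exists2 e, pi e & b * val e = phi (pg_elt p) * val e.

Section OverTheory.
Variables (pi : idem B -> bool) (piP : boolalg_morphism pi).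

(** If [s] and [t] agree below an idempotent [f], then [phi s] and [phi t] agree
below [phi f], so any representative of the germ can serve. *)
Lemma overP b p : over pi b (pgerm p) <-> pg_chr p =1 pi \o phiE /\
  exists2 e, pi e & b * val e = phi (pg_elt p) * val e.
Proof.
rewrite /over srcE; split=> [] [pE]; last by move=> eP; split=> //; exists p.
move=> [q /pgermP[_ [f pf fE]] [e pe eE]]; split=> //.
exists (phiE f `&` e); first by rewrite pointI // pe -[pi _]/((pi \o phiE) f) -pE pf.
have fE' : phi (pg_elt p) * val (phiE f) = phi (pg_elt q) * val (phiE f).
  by rewrite /= -!phiM fE.
rewrite [val _](valC (phiE f) e).
by rewrite [LHS]mulgA eE -mulgA valC [LHS]mulgA -fE' -[LHS]mulgA; congr (_ * _).
Qed.

Lemma over_agree b c g : over pi b g -> over pi c g ->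
  exists2 e, pi e & b * val e = c * val e.
Proof.
have [p ->] := cyl_point g => /overP[_ [e pe eE]] /overP[_ [f pf fE]].
exists (e `&` f); first by rewrite pointI // pe.
by rewrite /= mulgA eE -mulgA valC mulgA -fE -mulgA.
Qed.

Lemma point_dom_elt p : pg_chr p =1 pi \o phiE -> pi (dom (phi (pg_elt p))).
Proof. by move=> pE; rewrite -(erestr_dom phiM) -[pi _]/((pi \o phiE) _) -pE pg_dom. Qed.

Lemma point_dom_agree b c e : pi e -> b * val e = c * val e ->
  pi (dom b) = pi (dom c).
Proof.
move=> pe bc; have := congr1 (fun a => pi (dom a)) bc.
by rewrite /= !dom_mul !pointI // pe !andbT.
Qed.

Lemma over_dom b g : over pi b g -> pi (dom b).
Proof.
have [p ->] := cyl_point g => /overP[pE [e pe eE]].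
by rewrite (point_dom_agree pe eE) point_dom_elt.
Qed.

Lemma over_nle b c g : nle b c -> over pi b g -> over pi c g.
Proof.
move=> bc bg; have pb := over_dom bg; case: bg => gE [p gp [e pe eE]].
split=> //; exists p => //; exists (dom b `&` e); first by rewrite pointI // pb.
rewrite val_meet mulgA -nle_dom_mul // valC mulgA -eE -mulgA [val e * _]valC.
by rewrite mulgA mul_dom.
Qed.

Lemma point_econj_agree b c e f : pi e -> b * val e = c * val e ->
  pi (econj b f) = pi (econj c f).
Proof.
move=> pe bc; have := congr1 (fun a => pi (econj a f)) bc.
by rewrite /= !econj_mul !pointI // pe !andbT.
Qed.

(** The action of [b] on points corresponds to that of [g] on characters. *)
Lemma over_tgt b g : over pi b g -> tgt g =1 pi \o econj b \o phiE.
Proof.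
have [p ->] := cyl_point g => /overP[pE [e pe eE]] x.
rewrite tgtE /= /act_fun pE /= erestr_econj.
by rewrite (point_econj_agree _ pe eE).
Qed.

End OverTheory.

(** [b] is the value at [U] of the morphism to be constructed: its germs are
exactly those that lie above the germs in [U]. *)
Definition lifts (U : BX) b := forall pi, boolalg_morphism pi ->
  (pi (dom b) -> exists2 g, cob_set U g & over pi b g) /\
  (forall g, cob_set U g -> src g =1 pi \o phiE -> over pi b g).

Lemma lifts_inj U b c : lifts U b -> lifts U c -> b = c.
Proof.
have le a a' : lifts U a -> lifts U a' -> nle a a'.
  move=> aP a'P; apply: nle_points => pi piP /(aP _ piP).1[g Ug ag].
  by apply: (over_agree piP ag); apply: (a'P _ piP).2 => //; case: ag.
by move=> bP cP; apply: nle_dom_eq; [|apply: nle_dom]; exact: le.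
Qed.

Lemma lifts_biota s : lifts (biota X s) (phi s).
Proof.
move=> pi piP; split=> [ps|_ [p ps ->]].
  have [x xE] := xchar_point piP.
  have xs : x (dom s) by rewrite xE /= erestr_dom.
  exists (pgerm (PreGerm xs)); first by exists (PreGerm xs).
  by apply/(overP piP); split=> //; exists (dom (phi s)).
rewrite srcE => pE; apply/(overP piP); split=> //.
by exists (dom (phi s)); rewrite -ps // point_dom_elt.
Qed.

(** Germs multiply: [b * c] has at [pi] the product of the germ of [c] at [pi] and
the germ of [b] at the translate [pi \o econj c]. *)
Lemma lifts_mul U V b c : lifts U b -> lifts V c -> lifts (U * V) (b * c).
Proof.
move=> Ub Vc pi piP.
have mulP p q (pq : pg_chr p = act q) : over pi c (pgerm q) ->
    over (pi \o econj c) b (pgerm p) -> over pi (b * c) (pgerm (pmul pq)).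
  move=> cq bp; have pic := point_econj piP (over_dom piP cq).
  have [pE [f pf fE]] := (overP pic _ _).1 bp.
  have [qE [e pe eE]] := (overP piP _ _).1 cq.
  apply/(overP piP); split=> //; exists (econj c f `&` e).
    by rewrite pointI // pe andbT.
  rewrite /= phiM -[_ * val e]/(val (econj c f `&` e)).
  rewrite -[X in _ = _ * _ * X]/(val (econj c f `&` e)).
  rewrite -!mulgA [c * _]mulgA mul_econj -[val f * c * _]mulgA.
  rewrite [X in phi (pg_elt q) * X]valC [phi (pg_elt q) * _]mulgA -eE.
  rewrite -[c * val e * _]mulgA -[val e * _]valC [c * (_ * _)]mulgA mul_econj.
  by rewrite !mulgA fE.
split=> [pbc|_ /bmulP[p [q [pq [Up Vq ->]]]] gE].
  have pc : pi (dom c).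
    by apply: point_le pbc => //; rewrite dom_mulE econj_dom.
  have pic := point_econj piP pc.
  have [h Vh ch] := (Vc _ piP).1 pc.
  have [|g Ug bg] := (Ub _ pic).1; first by rewrite /= -dom_mulE.
  have gh : src g = tgt h.
    by apply: xchar_eq => x; rewrite (over_tgt piP ch) bg.1.
  exists (gmul gh); first by exists g, h, gh.
  move: gh Ug Vh bg ch; have [p ->] := cyl_point g; have [q ->] := cyl_point h.
  move=> gh _ _ bp cq; have pq : pg_chr p = act q by rewrite -srcE gh tgtE.
  by rewrite (gmulE pq); exact: mulP.
have qE : src (pgerm q) =1 pi \o phiE by move=> x; rewrite -gE !srcE.
have cq := (Vc _ piP).2 _ Vq qE.
apply: mulP => //; apply: (Ub _ (point_econj piP (over_dom piP cq))).2 => // x.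
by rewrite srcE pq -tgtE (over_tgt piP cq).
Qed.

Lemma lifts_inv U b : lifts U b -> lifts U^-1 b^-1.
Proof.
move=> Ub pi piP.
split=> [pb|_ [g Ug <-]].
  have pib := point_econj piP pb.
  have [|g Ug bg] := (Ub _ pib).1.
    by rewrite /= -dom_mulE; move: pb; congr (is_true (pi _)); apply/val_inj;
      rewrite /= sinvM sinvK !mulgA mulsVs.
  exists (ginv g); first by exists g.
  have tE := over_tgt pib bg.
  move: Ug bg tE; have [p ->] := cyl_point g => Ug.
  move=> /(overP pib)[pE [e pe eE]] tE; rewrite ginvE; apply/(overP piP).
  have [rE bE] := agree_inv eE; split; last first.
    by exists (econj b^-1 e) => //; rewrite /= bE morph_sinv.
  move=> x; have := tE x; rewrite tgtE /= => ->.
  have := econjVK b^-1 (phiE x); rewrite sinvK => ->.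
  by rewrite pointI // pb.
rewrite src_ginv; move: Ug; have [p ->] := cyl_point g => Up.
rewrite ginvE tgtE => pE.
(* It is not yet known that [b^-1] is defined at [pi], so [pi] is translated by
   the representative of the germ. *)
have piq := point_econj piP (point_dom_elt (p := Defs.pinv p) pE).
have /(overP piq)[_ [e pe eE]] : over (pi \o econj (phi (pg_elt p)^-1)) b (pgerm p).
  apply: (Ub _ piq).2 => // x; rewrite srcE -(act_pinv p) /= /act_fun pE /=.
  by rewrite erestr_econj.
have [rE bE] := agree_inv eE; apply/(overP piP); split=> //.
exists (econj b^-1 e); last by rewrite bE /= (morph_sinv phiM).
by rewrite rE -(morph_sinv phiM).
Qed.

(** Two units with the same source are equal, so for idempotents only the sources
matter; this turns [lifts] into a statement about Stone duality. *)
Lemma lifts_idem (E : idem BX) (e : idem B) : lifts (val E) (val e) <->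
  forall pi, boolalg_morphism pi ->
    (pi e <-> exists2 g, cob_set (val E) g & src g =1 pi \o phiE).
Proof.
split=> [Ee pi piP|Ee pi piP].
  have [H1 H2] := Ee pi piP; rewrite dom_val in H1; split=> [/H1[g Eg [gE _]]|].
    by exists g.
  by move=> [g Eg gE]; rewrite -(dom_val e); exact: over_dom (H2 _ Eg gE).
have unit_over g : cob_set (val E) g -> src g =1 pi \o phiE -> over pi (val e) g.
  move=> Eg gE; have pe : pi e by apply/(Ee _ piP); exists g.
  split=> //; have [p pp gp] := ebx_unit Eg; exists p => //.
  exists (e `&` phiE (mk_idem pp)).
    rewrite pointI // pe /= -[pi _]/((pi \o phiE) (mk_idem pp)) -gE gp srcE.
    by have := pg_dom p; congr (is_true (pg_chr p _)); apply/val_inj;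
      rewrite /= idem_inv // pp.
  rewrite -[phi (pg_elt p)]/(val (phiE (mk_idem pp))).
  move: (phiE (mk_idem pp)) => f.
  by rewrite val_meet mulgA idem_valK [in RHS]valC mulgA idem_valK valC.
split=> [|g]; last exact: unit_over.
by rewrite dom_val => /(Ee _ piP)[g Eg gE]; exists g => //; exact: unit_over.
Qed.

Lemma lifts_diff (E F : idem BX) (e f : idem B) : lifts (val E) (val e) ->
  lifts (val F) (val f) -> lifts (val (E `\` F)) (val (e `\` f)).
Proof.
move=> /lifts_idem Ee /lifts_idem Ff; apply/lifts_idem => pi piP.
rewrite pointD //; split=> [/andP[/(Ee _ piP)[g Eg gE] nf]|[g [Eg nFg] gE]].
  exists g => //; split=> // Fg; move: nf; apply/negP/negPn.
  by apply/(Ff _ piP); exists g.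
apply/andP; split; first by apply/(Ee _ piP); exists g.
apply/negP => /(Ff _ piP)[h Fh hE]; apply: nFg.
suff -> : g = h by [].
apply: unit_inj; [exact: ebx_unit Eg|exact: ebx_unit Fh|].
by apply: xchar_eq => x; rewrite gE hE.
Qed.

Lemma lifts_join U V W b c d : compatible U V -> is_join [set U; V] W ->
  is_join [set b; c] d -> lifts U b -> lifts V c -> lifts W d.
Proof.
move=> UV WP dP Ub Vc pi piP; rewrite (cob_set_join UV WP) (dom_join dP) pointU //.
have bd : nle b d by apply: dP.1; left.
have cd : nle c d by apply: dP.1; right.
split=> [/orP[/(Ub _ piP).1|/(Vc _ piP).1] [g Ug bg]|g [Ug|Vg] gE].
- by exists g; [left|exact: over_nle bd bg].
- by exists g; [right|exact: over_nle cd bg].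
- by apply: (over_nle piP bd); exact: (Ub _ piP).2.
- by apply: (over_nle piP cd); exact: (Vc _ piP).2.
Qed.

Lemma lifts_idempotent U b : lifts U b -> U * U = U -> b * b = b.
Proof. by move=> Ub UU; apply: (lifts_inj _ Ub); rewrite -UU; exact: lifts_mul. Qed.

(** Compatibility asks for certain products to be idempotent, and a lift of an
idempotent is idempotent, since [lifts] is multiplicative and functional. *)
Lemma lifts_compatible U V b c : lifts U b -> lifts V c -> compatible U V ->
  compatible b c.
Proof.
move=> Ub Vc [UV1 UV2]; split.
  exact: lifts_idempotent (lifts_mul (lifts_inv Ub) Vc) UV1.
exact: lifts_idempotent (lifts_mul Ub (lifts_inv Vc)) UV2.
Qed.

Lemma lifts_ex U : exists b, lifts U b.
Proof.
elim/booleanization_ind: U =>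
  [s|U V [b Ub] [c Vc]|E F [b Eb] [c Fc]|U V W UV WP [b Ub] [c Vc]].
- by exists (phi s); exact: lifts_biota.
- by exists (b * c); exact: lifts_mul.
- pose e := mk_idem (lifts_idempotent Eb (idem_valK E)).
  pose f := mk_idem (lifts_idempotent Fc (idem_valK F)).
  by exists (val (e `\` f)); exact: lifts_diff.
- have [d dP] := compatible_join _ _ (lifts_compatible Ub Vc UV).
  by exists d; exact: lifts_join UV WP dP Ub Vc.
Qed.

Lemma lifts_morphism (psi : BX -> B) : (forall U, lifts U (psi U)) ->
  bis_morphism psi /\ phi = psi \o biota X.
Proof.
move=> psiP; have psi_biota : phi = psi \o biota X.
  by apply/funext => s; exact: lifts_inj (lifts_biota s) (psiP _).
split=> //.
have psiM : semigroup_morphism psi.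
  by move=> U V; apply: lifts_inj (psiP _) _; exact: lifts_mul.
have psiJ U V W : compatible U V -> is_join [set U; V] W ->
    is_join [set psi U; psi V] (psi W).
  move=> UV WP.
  have [d dP] := compatible_join _ _ (lifts_compatible (psiP U) (psiP V) UV).
  have Wd := lifts_join UV WP dP (psiP U) (psiP V).
  by rewrite (lifts_inj (psiP W) Wd).
have psiE (E : idem BX) : lifts (val E) (val (erestr psiM E)) by exact: psiP.
exists psiM => //; split.
- apply/val_inj; apply: lifts_inj (psiE _) _; apply/lifts_idem => pi piP.
  by rewrite point0 //; split=> // -[g []].
- move=> E F; apply/val_inj; apply: is_join_uniq (ejoin_is_join _ _).
  apply: psiJ; last exact: ejoin_is_join.
  by apply: nle_compatible; apply: nle_val; [exact: leUl|exact: leUr].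
- by move=> E F; apply/val_inj; rewrite /= psiM.
- move=> E F; apply/val_inj; apply: lifts_inj (psiE _) _.
  exact: lifts_diff.
- move=> y; have [s ys] := tj_proper phiX y; exists [seq ebiota X e | e <- s].
  rewrite big_map; suff <- : \join_(x <- s) phiE x =
    \join_(x <- s) erestr psiM (ebiota X x) by [].
  apply: eq_bigr => e _; apply/val_inj; by rewrite /= psi_biota.
Qed.

End Lifting.

Theorem theorem3p12 (S : invSemigroupType)
    (X : set (idem S * {fset idem S})) (B : boolInvSemigroupType)
    (phi : S -> B) :
  (to_join_representation X phi ->
    exists! psi : booleanization X -> B,
      bis_morphism psi /\ phi = psi \o biota X) /\
  (to_join_representation X phi -> is_proper phi ->
    exists! psi : booleanization X -> B,
      [/\ bis_morphism psi, is_proper psi & phi = psi \o biota X]).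
Proof.
have exu : to_join_representation X phi ->
    exists! psi : booleanization X -> B,
      bis_morphism psi /\ phi = psi \o biota X.
  move=> [phiM phiX]; have [psi psiP] := choice (lifts_ex phiX).
  have [psi_bis psi_biota] := lifts_morphism phiX psiP.
  exists psi; split=> // psi' [psi'_bis psi'_biota].
  by apply: bis_morphism_ext => //; rewrite -psi_biota.
split=> // /exu[psi [[psi_bis psi_biota] psi_uniq]] phi_proper.
exists psi; split=> [|psi' [psi'_bis _ psi'_biota]]; last exact: psi_uniq.
split=> // t; have [n [u [s [uP us]]]] := phi_proper t.
by exists n, u, (biota X \o s); split=> // i; move: (us i); rewrite psi_biota.
Qed.
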